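(* Let $S_1,\dots,S_n \subset \mathbb{Q}^n$ be finite sets and let $\tilde{S} = S_1 \cup \cdots \cup S_n$. If for every proper positive dimensional face $F$ of $\operatorname{conv}(\tilde{S})$ we have $F \cap S_i \neq \varnothing$ for each $i = 1,\dots,n$, then \[ \operatorname{MV}(\operatorname{conv} S_1,\dots,\operatorname{conv} S_n) = n!\,\operatorname{vol}_n(\operatorname{conv}(\tilde{S})). \]
   Context: For convex polytopes $Q_1,\dots,Q_n\subset\mathbb{R}^n$, the mixed volume $\operatorname{MV}(Q_1,\dots,Q_n)$ is the coefficient of $\lambda_1\cdots\lambda_n$ in the polynomial $\operatorname{vol}_n(\lambda_1Q_1+\cdots+\lambda_nQ_n)$ (Minkowski sum, $\lambda_i>0$), where $\operatorname{vol}_n$ is Euclidean volume. For a compact set $Q$ and nonzero $\alpha\in\mathbb{R}^n$, let $h_\alpha(Q)=\min\{\langle q,\alpha\rangle : q\in Q\}$ and $(Q)_\alpha=\{q\in Q:\langle q,\alpha\rangle=h_\alpha(Q)\}$. A face of a convex polytope $P$ is a subset of the form $(P)_\alpha$ for some nonzero $\alpha$; a face of dimension $0$ is a vertex, other nonempty faces are positive dimensional. *)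

(* Defs.v *)
From HB Require Import structures.
From mathcomp Require Import all_boot all_order all_algebra.
From mathcomp Require Import all_classical all_reals all_analysis.
Set Implicit Arguments. Unset Strict Implicit. Unset Printing Implicit Defensive.
Import Order.TTheory GRing.Theory Num.Theory.
Local Open Scope classical_set_scope.
Local Open Scope ring_scope.

Definition dotp (R : realType) (n : nat) (x a : 'rV[R]_n) : R :=
  \sum_(j < n) x ord0 j * a ord0 j.

Definition conv_hull (R : realType) (n : nat) (A : set 'rV[R]_n) : set 'rV[R]_n :=
  [set x | exists (m : nat) (w : 'I_m -> R) (p : 'I_m -> 'rV[R]_n),
      [/\ forall i, 0 <= w i, \sum_(i < m) w i = 1,
          forall i, A (p i) & x = \sum_(i < m) w i *: p i]].

Definition face_dir (R : realType) (n : nat) (Q : set 'rV[R]_n) (alpha : 'rV[R]_n)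
  : set 'rV[R]_n :=
  [set q | Q q /\ forall y, Q y -> dotp q alpha <= dotp y alpha].

Definition is_face (R : realType) (n : nat) (P F : set 'rV[R]_n) : Prop :=
  exists alpha : 'rV[R]_n, alpha != 0 /\ F = face_dir P alpha.

(* A nonempty convex set has positive dimension iff it is not a single point,
   i.e. it contains two distinct points. *)
Definition positive_dim (R : realType) (n : nat) (F : set 'rV[R]_n) : Prop :=
  exists x y, [/\ F x, F y & x != y].

(* Iterated Lebesgue integral over coordinates k-1, ..., 0 (Fubini–Tonelli
   definition of n-dimensional Lebesgue measure). *)
Fixpoint iint (R : realType) (n : nat) (k : nat) (f : 'rV[R]_n -> \bar R)
  (v : 'rV[R]_n) {struct k} : \bar R :=
  match k with
  | 0 => f v
  | k'.+1 => (\int[@lebesgue_measure R]_t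
                iint k' f (\row_j (if (j : nat) == k' then t else v ord0 j)))%E
  end.

Definition vol (R : realType) (n : nat) (A : set 'rV[R]_n) : \bar R :=
  iint n (fun x => (\1_A x)%:E) 0.

Definition msum (R : realType) (n : nat) (lam : 'I_n -> R)
  (Q : 'I_n -> set 'rV[R]_n) : set 'rV[R]_n :=
  [set x | exists q : 'I_n -> 'rV[R]_n,
      (forall i, Q i (q i)) /\ x = \sum_(i < n) lam i *: q i].

(* c is the coefficient of lambda_1 ... lambda_n in a polynomial
   (coefficients a e on monomials prod_i lambda_i^(e i), exponents < d+2)
   equal to vol(lambda_1 Q_1 + ... + lambda_n Q_n) for all lambda_i > 0. *)
Definition is_mixed_volume (R : realType) (n : nat) (Q : 'I_n -> set 'rV[R]_n)
  (c : R) : Prop :=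
  exists (d : nat) (a : {ffun 'I_n -> 'I_d.+2} -> R),
    (forall lam : 'I_n -> R, (forall i, 0 < lam i) ->
       vol (msum lam Q) =
       (\sum_(e : {ffun 'I_n -> 'I_d.+2}) a e * \prod_(i < n) lam i ^+ e i)%:E)
    /\ c = a [ffun _ => inord 1].

Definition mixed_volume (R : realType) (n : nat) (Q : 'I_n -> set 'rV[R]_n) : R :=
  xget 0 [set c | is_mixed_volume Q c].

Definition ratv (R : realType) (n : nat) (s : 'rV[rat]_n) : 'rV[R]_n :=
  map_mx (@ratr R) s.

(* Main.v *)
(* Polynomiality.  A point x lies in the Minkowski sum with weights lam iff
   (lam, x) is a conic combination of the Cayley vectors (e_i, p), p in S_i.
   For a generic positive cost, the optimal bases of this linear program cut
   the Minkowski sum into disjoint cells, up to a null set, independently of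
   lam; each cell is a fixed affine image of a product of simplices dilated by
   the lam_i, so its volume is a constant times a monomial of degree n.

   The coefficient.  Let v be an exposed point of P = conv(St) lying in S_j, and
   add v to S_i for some i <> j.  The points gained by the Minkowski sum are cut
   off by normals in the normal cone of v, because every proper face of
   positive dimension meets S_i; since v is in S_j, the gained region is merely
   translated by s v when lam_j grows by s.  Hence the gained volume does not
   depend on lam_j, and the coefficient of lam_1 ... lam_n is unchanged.  After
   adding all exposed points everywhere, each body is P, and
   vol ((lam_1 + ... + lam_n) P) = (lam_1 + ... + lam_n)^n vol P. *)

Require Import Defs.
From HB Require Import structures.
From mathcomp Require Import all_boot all_order all_algebra.
From mathcomp Require Import all_classical all_reals all_analysis.
From mathcomp Require Import perm measurable_realfun.
From mathcomp Require Import lra ring.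
Set Implicit Arguments. Unset Strict Implicit. Unset Printing Implicit Defensive.
Import Order.TTheory GRing.Theory Num.Theory.
Local Open Scope classical_set_scope.
Local Open Scope ring_scope.

(** * Iterated Lebesgue integrals and volume *)

Section IteratedIntegral.
Variable R : realType.
Local Notation mR := (measurableTypeR R).
Local Notation mu := (@lebesgue_measure R).

(** The cells can be chosen uniformly in lam because dual feasibility of a basis mentions only the
    Cayley vectors and the costs, never the right-hand side (lam, x); genericity makes all reduced
    costs nonzero. Since [vol] is an iterated integral, its behaviour under linear maps is derived
    from Tonelli and one-variable substitutions. The Jacobian constant is absorbed into the
    coefficient of a cell; only the diagonal scaling by the weights is computed exactly.

    The translation step rests on Farkas certificates: a point lies outside a Minkowski sum iff some
    normal, with a lower bound for each body, refutes it. When the normals refuting two related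
    points lie inside and outside the normal cone of v, they are added with the multiplier that
    lands on a wall of that cone, where a point of S_i ties with v. Such ties are the form in which
    the face hypothesis enters.

    Two degenerate cases need separate care: a flat P, where a wall may cut out all of P instead of
    a proper face, and an empty S_i, where both sides are 0. *)

Definition row_of_tuple n (t : n.-tuple mR) : 'rV[R]_n := \row_j tnth t j.

(** Measurability is transported from the product sigma-algebra on tuples, so composing with a map
    into rows only requires its coordinates to be measurable. *)
Definition row_measurable n (f : 'rV[R]_n -> \bar R) :=
  measurable_fun [set: n.-tuple mR] (f \o @row_of_tuple n).

Lemma row_measurable_comp d (T : measurableType d) n (f : 'rV[R]_n -> \bar R)
    (g : T -> 'rV[R]_n) :
  row_measurable f ->
  (forall j, measurable_fun [set: T] (fun x => g x ord0 j : mR)) ->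
  measurable_fun [set: T] (f \o g).
Proof.
move=> mf mg; pose h x : n.-tuple mR := [tuple g x ord0 j | j < n].
have -> : f \o g = (f \o @row_of_tuple n) \o h.
  apply/funext => x /=; congr f; apply/rowP => j.
  by rewrite mxE tnth_mktuple.
apply: measurableT_comp => //; apply/measurable_fun_tnthP => j.
rewrite (_ : _ \o _ = fun x => g x ord0 j) //.
by apply/funext => x /=; rewrite tnth_mktuple.
Qed.

Lemma measurable_row_coord n (j : 'I_n) :
  measurable_fun [set: n.-tuple mR] (fun t => row_of_tuple t ord0 j : mR).
Proof.
rewrite (_ : (fun _ => _) = (@tnth n mR ^~ j)); first exact: measurable_tnth.
by apply/funext => t; rewrite mxE.
Qed.

Definition upd n (v : 'rV[R]_n) (i : nat) (t : R) : 'rV[R]_n :=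
  \row_j (if (j : nat) == i then t else v ord0 j).

Lemma upd_comm n (v : 'rV[R]_n) i j s t : i != j ->
  upd (upd v i s) j t = upd (upd v j t) i s.
Proof.
move=> ij; apply/rowP => k; rewrite !mxE.
by case: eqP => // ->; rewrite eq_sym (negPf ij).
Qed.

Definition Int n (i : nat) (f : 'rV[R]_n -> \bar R) (v : 'rV[R]_n) : \bar R :=
  (\int[mu]_t f (upd v i t))%E.

Lemma measurable_upd n i (f : 'rV[R]_n -> \bar R) v :
  row_measurable f -> measurable_fun [set: mR] (fun t => f (upd v i t)).
Proof.
move=> mf; apply: (@row_measurable_comp _ _ _ f (fun t => upd v i t)) => // j.
rewrite (_ : (fun _ => _) =
    if (j : nat) == i then id else fun=> v ord0 j); first by case: ifP.
by apply/funext => t; rewrite mxE; case: ifP.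
Qed.

Lemma measurable_upd2 n i (f : 'rV[R]_n -> \bar R) :
  row_measurable f -> measurable_fun [set: n.-tuple mR * mR]
    (fun p => f (upd (row_of_tuple p.1) i p.2)).
Proof.
move=> mf; apply: (@row_measurable_comp _ _ _ f
  (fun p : n.-tuple mR * mR => upd (row_of_tuple p.1) i p.2)) => // j.
rewrite (_ : (fun _ => _) = if (j : nat) == i then snd else
    (fun t => row_of_tuple t ord0 j : mR) \o fst); last first.
  by apply/funext => t; rewrite mxE; case: ifP.
case: ifP => _ //; apply: measurableT_comp => //.
exact: measurable_row_coord.
Qed.

Lemma row_measurable_Int n i (f : 'rV[R]_n -> \bar R) :
  row_measurable f -> (forall x, 0 <= f x)%E -> row_measurable (Int i f).
Proof.
move=> mf f0; rewrite /row_measurable.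
exact: (@measurable_fun_fubini_tonelli_F _ _ _ _ R mu
  (fun p : n.-tuple mR * mR => f (upd (row_of_tuple p.1) i p.2))
  (measurable_upd2 i mf) (fun=> f0 _)).
Qed.

Lemma Int_ge0 n i (f : 'rV[R]_n -> \bar R) v :
  (forall x, 0 <= f x)%E -> (0 <= Int i f v)%E.
Proof. by move=> f0; apply: integral_ge0 => *. Qed.

Lemma Int_comm n i j (f : 'rV[R]_n -> \bar R) :
  row_measurable f -> (forall x, 0 <= f x)%E ->
  Int i (Int j f) = Int j (Int i f).
Proof.
move=> mf f0; have [->//|ij] := eqVneq i j.
apply/funext => v; rewrite /Int.
have := @fubini_tonelli _ _ mR mR R mu mu
  (fun p => f (upd (upd v i p.1) j p.2)).
move=> -> //=.
  by apply: eq_integral => t _; apply: eq_integral => s _; rewrite upd_comm.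
apply: (@row_measurable_comp _ _ _ f
  (fun p : mR * mR => upd (upd v i p.1) j p.2)) => // k.
rewrite (_ : (fun _ => _) = if (k : nat) == j then snd else
    if (k : nat) == i then fst else cst (v ord0 k)); last first.
  by apply/funext => t; rewrite !mxE; case: ifP => //; case: ifP.
by case: ifP => // _; case: ifP.
Qed.

(** [iint] becomes a composition of one-coordinate operators along a list, so that reordering the
    integration is permuting the list. *)
Definition Ints n (s : seq nat) (f : 'rV[R]_n -> \bar R) := foldr (@Int n) f s.

Lemma Ints_ge0 n s (f : 'rV[R]_n -> \bar R) v :
  (forall x, 0 <= f x)%E -> (0 <= Ints s f v)%E.
Proof. by move=> f0; elim: s v => //= i s IH v; exact: Int_ge0. Qed.

Lemma row_measurable_Ints n s (f : 'rV[R]_n -> \bar R) :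
  row_measurable f -> (forall x, 0 <= f x)%E -> row_measurable (Ints s f).
Proof.
by move=> mf f0; elim: s => //= i s IH; apply: row_measurable_Int => // x;
  exact: Ints_ge0.
Qed.

Lemma Ints_cat n s1 s2 (f : 'rV[R]_n -> \bar R) :
  Ints (s1 ++ s2) f = Ints s1 (Ints s2 f).
Proof. exact: foldr_cat. Qed.

Lemma Ints_mid n s1 s2 i (f : 'rV[R]_n -> \bar R) :
  row_measurable f -> (forall x, 0 <= f x)%E ->
  Ints (s1 ++ i :: s2) f = Ints (i :: s1 ++ s2) f.
Proof.
move=> mf f0; elim: s1 => //= j s1 ->; rewrite /= Int_comm//.
  exact: row_measurable_Ints.
by move=> x; exact: Ints_ge0.
Qed.

(** Swaps are Tonelli ([Int_comm]); they allow any chosen coordinate to be integrated innermost. *)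
Lemma Ints_perm n s1 s2 (f : 'rV[R]_n -> \bar R) :
  row_measurable f -> (forall x, 0 <= f x)%E ->
  perm_eq s1 s2 -> Ints s1 f = Ints s2 f.
Proof.
move=> mf f0; elim: s1 s2 => [|i s1 IH] s2 s12.
  by move: s12; rewrite perm_sym => /perm_nilP ->.
have : i \in s2 by rewrite -(perm_mem s12) mem_head.
move=> /path.splitPr h; case: h s12 => p1 p2 s12.
rewrite Ints_mid//= (IH (p1 ++ p2))//.
by rewrite -(perm_cons i) (perm_trans s12)// perm_catC/= perm_cons perm_catC.
Qed.

Lemma iintE n k (f : 'rV[R]_n -> \bar R) : iint k f = Ints (rev (iota 0 k)) f.
Proof.
elim: k => [//|k IH].
rewrite -[X in iota _ X]addn1 iotaD/= rev_cat/= add0n.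
by apply/funext => v; rewrite /= IH.
Qed.

Lemma iint_ge0 n k (f : 'rV[R]_n -> \bar R) v :
  (forall x, 0 <= f x)%E -> (0 <= iint k f v)%E.
Proof. by move=> f0; rewrite iintE; exact: Ints_ge0. Qed.

Lemma row_measurable_iint n k (f : 'rV[R]_n -> \bar R) :
  row_measurable f -> (forall x, 0 <= f x)%E -> row_measurable (iint k f).
Proof. by move=> mf f0; rewrite iintE; exact: row_measurable_Ints. Qed.

Lemma le_Ints n s (f g : 'rV[R]_n -> \bar R) v :
  row_measurable f -> row_measurable g -> (forall x, 0 <= f x)%E ->
  (forall x, f x <= g x)%E -> (Ints s f v <= Ints s g v)%E.
Proof.
move=> mf mg f0 fg; have g0 x : (0 <= g x)%E by apply: le_trans (fg x).
elim: s v => [//|i s IH v] /=; apply: ge0_le_integral => //.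
- by move=> t _; exact: Ints_ge0.
- by apply: (measurable_upd i v); exact: row_measurable_Ints.
- by apply: (measurable_upd i v); exact: row_measurable_Ints.
Qed.

Lemma le_iint n k (f g : 'rV[R]_n -> \bar R) v :
  row_measurable f -> row_measurable g -> (forall x, 0 <= f x)%E ->
  (forall x, f x <= g x)%E -> (iint k f v <= iint k g v)%E.
Proof. by rewrite !iintE; exact: le_Ints. Qed.

Lemma iintD n k (f g : 'rV[R]_n -> \bar R) v :
  row_measurable f -> row_measurable g ->
  (forall x, 0 <= f x)%E -> (forall x, 0 <= g x)%E ->
  (iint k (fun x => f x + g x) v = iint k f v + iint k g v)%E.
Proof.
move=> mf mg f0 g0; elim: k v => //= k IH v.
under eq_integral do rewrite IH.
rewrite ge0_integralD//.
- by move=> *; exact: iint_ge0.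
- by apply: (measurable_upd k v); exact: row_measurable_iint.
- by move=> *; exact: iint_ge0.
- by apply: (measurable_upd k v); exact: row_measurable_iint.
Qed.

Lemma Ints_scale n s (f : 'rV[R]_n -> \bar R) (c : R) v : 0 <= c ->
  row_measurable f -> (forall x, 0 <= f x)%E ->
  (Ints s (fun x => c%:E * f x) v = c%:E * Ints s f v)%E.
Proof.
move=> c0 mf f0; elim: s v => //= i s IH v; rewrite /Int.
under eq_integral do rewrite IH.
rewrite ge0_integralZl//; last by move=> *; exact: Ints_ge0.
by apply: (measurable_upd i v); exact: row_measurable_Ints.
Qed.

(** * Linear change of variables *)

Lemma lebesgue_affine_pos (a b : R) (f : R -> \bar R) : 0 < a ->
  measurable_fun [set: mR] f -> (forall x, 0 <= f x)%E ->
  (\int[mu]_t f t = a%:E * \int[mu]_t f (a * t + b)%R)%E.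
Proof.
move=> a0 mf f0; pose phi (t : mR) : mR := a * t + b.
have mphi : measurable_fun setT phi.
  apply: measurable_funD => //; exact: mulrl_measurable.
(* The scaled pushforward has the Lebesgue value on half-open intervals, so uniqueness of Lebesgue
   measure identifies the two. *)
have mE (A : set mR) : measurable A ->
    mu A = mscale (NngNum (ltW a0)) (pushforward mu phi) A.
  apply: lebesgue_measure_unique => _ [[x y]] _ <-.
  transitivity (a%:E * mu (phi @^-1` `]x, y]))%E; last by [].
  have -> : phi @^-1` `]x, y]%classic = `](x - b) / a, (y - b) / a]%classic.
    apply/seteqP; split => t /=; rewrite /phi !in_itv /= => /andP[h1 h2].
      by rewrite ltr_pdivrMr// ler_pdivlMr//; apply/andP; split; nra.
    by move: h1 h2; rewrite ltr_pdivrMr// ler_pdivlMr// => h1 h2;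
      apply/andP; split; nra.
  rewrite !lebesgue_measure_itv /= !lte_fin ltr_pM2r ?invr_gt0// ltrD2r.
  case: ifP => _; last by rewrite mule0.
  by rewrite -!EFinB -EFinM; congr EFin; field; rewrite gt_eqF.
rewrite (eq_measure_integral (mscale (NngNum (ltW a0)) (pushforward mu phi))).
  rewrite ge0_integral_mscale//; congr (_ * _)%E.
  by rewrite ge0_integral_pushforward.
by move=> A mA _; exact: mE.
Qed.

Lemma lebesgue_opp (f : R -> \bar R) :
  measurable_fun [set: mR] f -> (forall x, 0 <= f x)%E ->
  (\int[mu]_t f t = \int[mu]_t f (- t)%R)%E.
Proof.
move=> mf f0.
transitivity (\int[pushforward mu (-%R : _ -> mR)]_t f t)%E.
  apply: eq_measure_integral => A mA _; exact/esym/lebesgue_measureN.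
rewrite ge0_integral_pushforward//.
Qed.

Lemma lebesgue_affine (a b : R) (f : R -> \bar R) : a != 0 ->
  measurable_fun [set: mR] f -> (forall x, 0 <= f x)%E ->
  (\int[mu]_t f t = `|a|%:E * \int[mu]_t f (a * t + b)%R)%E.
Proof.
move=> a0 mf f0; have [ap|an|/eqP] := ltrgt0P a; last by rewrite (negPf a0).
  by rewrite (lebesgue_affine_pos b ap).
have an' : 0 < - a by rewrite oppr_gt0.
rewrite (lebesgue_affine_pos b an')//; congr (_ * _)%E.
rewrite [RHS]lebesgue_opp//; first by under eq_integral do rewrite mulNr -mulrN.
apply: measurableT_comp => //; apply: measurable_funD => //.
Qed.

(** Coordinates below [k] are overwritten by the integration variables. *)
Lemma iint_indep n k (f : 'rV[R]_n -> \bar R) (v w : 'rV[R]_n) :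
  (forall j : 'I_n, (k <= j)%N -> v ord0 j = w ord0 j) ->
  iint k f v = iint k f w.
Proof.
elim: k v w => [|k IH] v w vw.
  by have -> : v = w by apply/rowP => j; exact: vw.
apply: eq_integral => t _; apply: IH => j kj; rewrite !mxE.
case: eqP => // /eqP jk; apply: vw; rewrite ltn_neqAle eq_sym jk kj//.
Qed.

Lemma iint_full_indep n (f : 'rV[R]_n -> \bar R) (v w : 'rV[R]_n) : iint n f v = iint n f w.
Proof. by apply: iint_indep => j; rewrite leqNgt ltn_ord. Qed.

Lemma row_measurable_mulmx n m (f : 'rV[R]_m -> \bar R) (M : 'M[R]_(n, m)) (b : 'rV[R]_m) :
  row_measurable f -> row_measurable (fun x : 'rV_n => f (x *m M + b)).
Proof.
move=> mf; apply: (row_measurable_comp (f := f)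
  (g := fun t : n.-tuple mR => row_of_tuple t *m M + b)) => // j.
under eq_fun do rewrite !mxE.
apply: measurable_funD => //; apply: measurable_sum => k.
by apply: measurable_funM => //; exact: measurable_row_coord.
Qed.

Lemma row_measurable_mul n m (f : 'rV[R]_m -> \bar R) (M : 'M[R]_(n, m)) :
  row_measurable f -> row_measurable (fun x : 'rV_n => f (x *m M)).
Proof.
move=> mf; rewrite (_ : (fun _ => _) = fun x => f (x *m M + 0)).
  exact: row_measurable_mulmx.
by apply/funext => x; rewrite addr0.
Qed.

(** A triangular matrix acts as a succession of single-column maps; [J] records the columns already
    applied. *)
Definition colsel n (J : {set 'I_n}) (M : 'M[R]_n) : 'M[R]_n :=
  \matrix_(k, j) (if j \in J then M k j else (k == j)%:R).

(** The coordinates changed so far do not enter the new column, so applying it afterwards equals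
    applying all columns at once. *)
Lemma colselS n (J : {set 'I_n}) (M : 'M[R]_n) j :
  (forall k, k \in J -> M k j = 0) ->
  colsel J M *m colsel [set j] M = colsel (j |: J) M.
Proof.
move=> MJ; apply/matrixP => k l; rewrite !mxE in_setU1.
under eq_bigr do rewrite !mxE finset.in_set1.
case: eqP => [->|lj] /=; last first.
  rewrite (bigD1 l)//= big1 ?addr0 ?eqxx ?mulr1// => i il.
  by rewrite (negPf il) mulr0.
case jJ : (j \in J).
  rewrite (bigD1 k)//= eqxx big1 ?addr0.
    by case: ifP => [kJ|]; rewrite ?mul1r//
      MJ// mulr0.
  move=> i ik; case: ifP => [/MJ ->|_]; first by rewrite mulr0.
  by rewrite eq_sym (negPf ik) mul0r.
rewrite (bigD1 k)//= eqxx big1 ?addr0.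
  by case: ifP => [kJ|]; rewrite ?mul1r// MJ// mulr0.
move=> i ik; case: ifP => [/MJ ->|_]; first by rewrite mulr0.
by rewrite eq_sym (negPf ik) mul0r.
Qed.

Lemma iint_last n (f g : 'rV[R]_n -> \bar R) (j : 'I_n) (c : R) v : 0 <= c ->
  row_measurable f -> (forall x, 0 <= f x)%E ->
  row_measurable g -> (forall x, 0 <= g x)%E ->
  (forall x, Int j f x = c%:E * Int j g x)%E ->
  (iint n f v = c%:E * iint n g v)%E.
Proof.
move=> c0 mf f0 mg g0 fg; rewrite !iintE.
pose o := rem (j : nat) (rev (iota 0 n)).
have op : perm_eq (rev (iota 0 n)) (o ++ [:: (j : nat)]).
  rewrite cats1 perm_sym (perm_trans (_ : perm_eq _ (nat_of_ord j :: o)))//.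
    by rewrite perm_rcons.
  by rewrite perm_sym perm_to_rem// mem_rev mem_iota /= ltn_ord.
rewrite !(Ints_perm _ _ op)// !Ints_cat.
have -> : Ints [:: (j : nat)] f = (fun x => c%:E * Int j g x)%E.
  by apply/funext => x; rewrite /= fg.
rewrite Ints_scale//; first exact: row_measurable_Int.
by move=> x; exact: Int_ge0.
Qed.

(** With the other coordinates fixed, the map is an affine substitution in coordinate [j] with slope
    [M j j]. *)
Lemma iint_col1 n (f : 'rV[R]_n -> \bar R) (j : 'I_n) (M : 'M[R]_n) v :
  row_measurable f -> (forall x, 0 <= f x)%E -> M j j != 0 ->
  (iint n f v = `|M j j|%:E * iint n (fun x => f (x *m colsel [set j] M)) v)%E.
Proof.
move=> mf f0 Mj; apply: (@iint_last _ _ _ j) => //.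
  exact: row_measurable_mul.
move=> x; rewrite /Int.
rewrite (lebesgue_affine (\sum_(k | k != j) x ord0 k * M k j) Mj)//; last first.
  exact: measurable_upd.
congr (_ * _)%E; apply: eq_integral => t _; congr f.
apply/rowP => l; rewrite !mxE.
under [in RHS]eq_bigr do rewrite !mxE finset.in_set1.
have [->|lj] := eqVneq l j.
  rewrite eqxx [in RHS](bigD1 j)//= !eqxx mulrC; congr (_ + _).
  by apply: eq_bigr => k kj; rewrite ifN.
rewrite ifN; last by apply: contra lj => /eqP/val_inj ->.
rewrite (bigD1 l)//= eqxx mulr1 ifN; last by apply: contra lj => /eqP/val_inj ->.
by rewrite big1 ?addr0// => k kl; rewrite (negPf kl) mulr0.
Qed.

(** The list [s] orders the columns so that each ignores the coordinates listed before it: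
    increasing for lower triangular, decreasing for upper triangular matrices. *)
Lemma iint_colsel n (f : 'rV[R]_n -> \bar R) (s : seq 'I_n) (M : 'M[R]_n) v :
  row_measurable f -> (forall x, 0 <= f x)%E -> (forall j, M j j != 0) ->
  pairwise (fun k j => M k j == 0) s ->
  (iint n f v = (\prod_(j <- s) `|M j j|)%:E *
     iint n (fun x => f (x *m colsel [set j in s] M)) v)%E.
Proof.
move=> mf f0 Mj; elim/last_ind: s f mf f0 => [|s j IH] f mf f0.
  rewrite big_nil mul1e => _; congr (iint n _ v); apply/funext => x; congr f.
  rewrite (_ : colsel _ _ = 1%:M) ?mulmx1//.
  by apply/matrixP => k l; rewrite !mxE inE.
rewrite pairwise_rcons => /andP[/allP Ms sM].
rewrite (iint_col1 (j := j) v mf f0 (Mj j)).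
rewrite IH//; first last.
  exact: row_measurable_mul.
rewrite muleA -EFinM big_rcons/= mulrC.
congr (_ * iint n _ v)%E; apply/funext => x; rewrite -mulmxA colselS.
  by congr (f (_ *m colsel _ _)); apply/setP => k; rewrite !inE mem_rcons inE.
by move=> k; rewrite inE => /Ms/eqP.
Qed.

Lemma iint_lower n (f : 'rV[R]_n -> \bar R) (M : 'M[R]_n) v :
  row_measurable f -> (forall x, 0 <= f x)%E -> (forall j, M j j != 0) ->
  (forall k j : 'I_n, (k < j)%N -> M k j = 0) ->
  (iint n f v = (\prod_j `|M j j|)%:E * iint n (fun x => f (x *m M)) v)%E.
Proof.
move=> mf f0 Mj Mz; rewrite (iint_colsel (s := enum 'I_n) v mf f0 Mj).
  rewrite big_enum/= (_ : colsel _ _ = M)//; apply/matrixP => k l.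
  by rewrite !mxE inE mem_enum.
have : pairwise ltn (map val (enum 'I_n)).
  rewrite val_enum_ord -sorted_pairwise; last exact: ltn_trans.
  exact: iota_ltn_sorted.
rewrite pairwise_map; apply: sub_pairwise => k j /= /Mz ->//.
Qed.

Lemma iint_upper n (f : 'rV[R]_n -> \bar R) (M : 'M[R]_n) v :
  row_measurable f -> (forall x, 0 <= f x)%E -> (forall j, M j j != 0) ->
  (forall k j : 'I_n, (j < k)%N -> M k j = 0) ->
  (iint n f v = (\prod_j `|M j j|)%:E * iint n (fun x => f (x *m M)) v)%E.
Proof.
move=> mf f0 Mj Mz; rewrite (iint_colsel (s := rev (enum 'I_n)) v mf f0 Mj).
  rewrite big_rev big_enum/= (_ : colsel _ _ = M)//; apply/matrixP => k l.
  by rewrite !mxE inE mem_rev mem_enum.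
have : pairwise gtn (map val (rev (enum 'I_n))).
  rewrite map_rev val_enum_ord -sorted_pairwise.
    by rewrite rev_sorted; exact: iota_ltn_sorted.
  by move=> a b c /= h1 h2; apply: ltn_trans h2 h1.
rewrite pairwise_map; apply: sub_pairwise => k j /= /Mz ->//.
Qed.

Lemma iint_perm n (f : 'rV[R]_n -> \bar R) (s : 'S_n) v :
  row_measurable f -> (forall x, 0 <= f x)%E ->
  iint n f v = iint n (fun x => f (col_perm s x)) v.
Proof.
move=> mf f0.
(* Permuting the coordinates of the argument only relabels the coordinate that each operator
   integrates. *)
have H (r : seq 'I_n) w : Ints (map val r) (fun x => f (col_perm s x)) w =
    Ints (map val (map (s^-1)%g r)) f (col_perm s w).
  elim: r w => //= i r IH w; apply: eq_integral => t _; rewrite IH.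
  congr (Ints _ f _); apply/rowP => j; rewrite !mxE.
  by rewrite !(inj_eq val_inj) -[X in s j == X](permKV s) (inj_eq perm_inj).
rewrite [RHS](iint_full_indep _ _ (col_perm s^-1 v)) !iintE.
have e : rev (iota 0 n) = map val (rev (enum 'I_n)).
  by rewrite map_rev val_enum_ord.
rewrite e H -col_permM mulgV col_perm1; congr (_ v).
apply: Ints_perm => //; apply: perm_map; apply: uniq_perm.
- by rewrite rev_uniq enum_uniq.
- by rewrite map_inj_uniq ?rev_uniq ?enum_uniq//; exact: perm_inj.
- move=> j; rewrite mem_rev mem_enum; apply/esym/mapP.
  by exists (s j); rewrite ?mem_rev ?mem_enum// permK.
Qed.

Lemma iint_translate n (f : 'rV[R]_n -> \bar R) (b : 'rV[R]_n) v :
  row_measurable f -> (forall x, 0 <= f x)%E ->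
  iint n (fun x => f (x + b)) v = iint n f v.
Proof.
move=> mf f0.
have H (r : seq 'I_n) w : Ints (map val r) (fun x => f (x + b)) w =
    Ints (map val r) f (w + b).
  elim: r w => //= i r IH w; rewrite [RHS]/Int [LHS]/Int.
  rewrite [RHS](lebesgue_affine (b ord0 i) (oner_neq0 R))//; first last.
    - by move=> t; exact: Ints_ge0.
    - by apply: (measurable_upd i); exact: row_measurable_Ints.
  rewrite normr1 mul1e; apply: eq_integral => t _; rewrite IH.
  congr (Ints _ f _); apply/rowP => j; rewrite !mxE mul1r.
  by case: eqP => // /val_inj ->.
rewrite [RHS](iint_full_indep _ _ (v + b)) !iintE.
have -> : rev (iota 0 n) = map val (rev (enum 'I_n)).
  by rewrite map_rev val_enum_ord.
exact: H.
Qed.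

(** An LUP factorization reduces the map to a permutation and two triangular maps. What matters
    later is that one constant serves every [f]. *)
Lemma iint_linear n (M : 'M[R]_n) : M \in unitmx ->
  exists2 c : R, 0 <= c & forall (f : 'rV[R]_n -> \bar R) v,
    row_measurable f -> (forall x, 0 <= f x)%E ->
    (iint n f v = c%:E * iint n (fun x => f (x *m M)) v)%E.
Proof.
case: n M => [|n] M uM.
  (* Dimension 0 is apart: all rows coincide there, while the LUP factorization takes a matrix of
     positive size. *)
  exists 1 => // f v mf f0; rewrite mul1e; congr (iint 0 _ v).
  by apply/funext => x; congr f; apply/rowP; case.
have := cormen_lup_correct M; have := cormen_lup_perm M.
have := cormen_lup_lower M; have := cormen_lup_upper M.
case: (cormen_lup M) => [[P L] U] /= hU hL /is_perm_mxP[s ->].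
rewrite -!mulmxE => PM.
have Lj j : L j j != 0 by rewrite hL// eqxx oner_eq0.
have detL : \det L = 1.
  rewrite det_trig; last by apply/is_trig_mxP => i j ij;
    rewrite hL ?(ltnW ij)// -val_eqE/= ltn_eqF.
  by apply: big1 => i _; rewrite hL// eqxx.
have uU : U \in unitmx.
  have : (perm_mx s *m M) \in unitmx by rewrite unitmx_mul unitmx_perm.
  by rewrite PM unitmx_mul => /andP[].
have Uj j : U j j != 0.
  move: uU; rewrite unitmxE -det_tr det_trig.
    rewrite unitfE prodf_seq_neq0 => /allP /(_ j).
    by rewrite mem_index_enum mxE => /(_ isT).
  by apply/is_trig_mxP => i k ik; rewrite mxE hU.
exists (\prod_j `|U j j| * \prod_j `|L j j|) => [|f v mf f0].
  by apply: mulr_ge0; apply: prodr_ge0.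
apply: etrans (iint_upper v mf f0 Uj hU) _.
rewrite EFinM -muleA; congr (_ * _)%E.
rewrite (iint_lower v (row_measurable_mul U mf) _ Lj)//; last first.
  by move=> k j kj; rewrite hL ?(ltnW kj)// -val_eqE/= ltn_eqF.
congr (_ * _)%E; rewrite (@iint_perm _ _ s)//; last first.
  apply: (row_measurable_mul (f := fun y => f (y *m U)) L).
  exact: row_measurable_mul.
congr (iint _ _ v); apply/funext => x; congr f.
rewrite col_permE -!mulmxA -PM [_ *m (perm_mx s *m M)]mulmxA.
by rewrite -perm_mxM mulVg perm_mx1 mul1mx.
Qed.

Lemma row_measurable_cst n (c : \bar R) :
  row_measurable (fun _ : 'rV[R]_n => c).
Proof. exact: measurable_cst. Qed.

Lemma row_measurable_sum n (I : Type) (s : seq I) (f : I -> 'rV[R]_n -> \bar R) :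
  (forall i, row_measurable (f i)) ->
  row_measurable (fun x => \sum_(i <- s) f i x)%E.
Proof. by move=> mf; exact: emeasurable_sum. Qed.

Lemma iint0 n k (v : 'rV[R]_n) : iint k (fun _ => 0%E : \bar R) v = 0%E.
Proof. by elim: k v => //= k IH v; under eq_integral do rewrite IH; rewrite integral0. Qed.

Lemma iint_sum n k (I : Type) (s : seq I) (f : I -> 'rV[R]_n -> \bar R) v :
  (forall i, row_measurable (f i)) -> (forall i x, 0 <= f i x)%E ->
  (iint k (fun x => \sum_(i <- s) f i x) v = \sum_(i <- s) iint k (f i) v)%E.
Proof.
move=> mf f0; elim: s => [|i s IH].
  by under eq_fun do rewrite big_nil; rewrite iint0 big_nil.
under eq_fun do rewrite big_cons.
rewrite iintD//; first by rewrite big_cons IH.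
- exact: row_measurable_sum.
- by move=> x; apply: sume_ge0.
Qed.

(** * Measurable sets of rows and their volume *)

Definition row_mset n (A : set 'rV[R]_n) :=
  measurable ((@row_of_tuple n) @^-1` A).

Lemma row_mset_indic n (A : set 'rV[R]_n) : row_mset A ->
  row_measurable (fun x => (\1_A x)%:E).
Proof.
move=> mA; apply: (measurableT_comp (f := EFin) (g := \1_((@row_of_tuple n) @^-1` A))) => //.
Qed.

Lemma row_mset0 n : row_mset (set0 : set 'rV[R]_n).
Proof. by rewrite /row_mset preimage_set0. Qed.

Lemma row_msetT n : row_mset (setT : set 'rV[R]_n).
Proof. by rewrite /row_mset preimage_setT. Qed.

Lemma row_msetI n (A B : set 'rV[R]_n) :
  row_mset A -> row_mset B -> row_mset (A `&` B).
Proof. by move=> mA mB; rewrite /row_mset preimage_setI; exact: measurableI. Qed.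

Lemma row_msetD n (A B : set 'rV[R]_n) :
  row_mset A -> row_mset B -> row_mset (A `\` B).
Proof.
move=> mA mB; rewrite /row_mset setDE preimage_setI preimage_setC.
by apply: measurableI => //; exact: measurableC.
Qed.

Lemma row_mset_exists n (I : finType) (A : I -> set 'rV[R]_n) :
  (forall i, row_mset (A i)) -> row_mset [set x | exists i, A i x].
Proof.
move=> mA; rewrite /row_mset.
rewrite (_ : _ @^-1` _ =
  \bigcup_(i in [set: I]) ((@row_of_tuple n) @^-1` A i)).
  by apply: fin_bigcup_measurable => // i _; exact: mA.
by apply/seteqP; split => [x [i h]|x [i _ h]]; exists i.
Qed.

Lemma row_mset_forall n (I : finType) (A : I -> set 'rV[R]_n) :
  (forall i, row_mset (A i)) -> row_mset [set x | forall i, A i x].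
Proof.
move=> mA; rewrite /row_mset.
rewrite (_ : _ @^-1` _ =
  \bigcap_(i in [set: I]) ((@row_of_tuple n) @^-1` A i)).
  by apply: fin_bigcap_measurable => // i _; exact: mA.
by apply/seteqP; split => [x h i _|x h i]; exact: h.
Qed.

Lemma measurable_row_affine n (c : R) (a : 'I_n -> R) :
  measurable_fun [set: n.-tuple mR]
    (fun t => c + \sum_j row_of_tuple t ord0 j * a j : mR).
Proof.
apply: measurable_funD => //; apply: measurable_sum => k.
by apply: measurable_funM => //; exact: measurable_row_coord.
Qed.

Lemma row_mset_affine n (c : R) (a : 'I_n -> R) (B : set R) :
  measurable (B : set mR) ->
  row_mset [set x : 'rV[R]_n | B (c + \sum_j x ord0 j * a j)].
Proof.
move=> mB; rewrite /row_mset.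
rewrite (_ : _ @^-1` _ = [set: n.-tuple mR] `&`
  (fun t => c + \sum_j row_of_tuple t ord0 j * a j : mR) @^-1` B).
  exact: measurable_row_affine.
by rewrite setTI.
Qed.

Lemma row_mset_le n (c : R) (a : 'I_n -> R) :
  row_mset [set x : 'rV[R]_n | 0 <= c + \sum_j x ord0 j * a j].
Proof.
rewrite (_ : [set _ | _] =
    [set x : 'rV[R]_n | `[0, +oo[%classic (c + \sum_j x ord0 j * a j)]).
  exact: row_mset_affine.
by apply/seteqP; split => x /=; rewrite in_itv/= andbT.
Qed.

Lemma row_mset_lt n (c : R) (a : 'I_n -> R) :
  row_mset [set x : 'rV[R]_n | 0 < c + \sum_j x ord0 j * a j].
Proof.
rewrite (_ : [set _ | _] =
    [set x : 'rV[R]_n | `]0, +oo[%classic (c + \sum_j x ord0 j * a j)]).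
  exact: row_mset_affine.
by apply/seteqP; split => x /=; rewrite in_itv/= andbT.
Qed.

Lemma row_mset_eq n (c : R) (a : 'I_n -> R) :
  row_mset [set x : 'rV[R]_n | c + \sum_j x ord0 j * a j = 0].
Proof. exact: (@row_mset_affine _ _ _ [set 0]). Qed.

Lemma indic_ge0 n (A : set 'rV[R]_n) x : (0 <= (\1_A x : R)%:E)%E.
Proof. by rewrite lee_fin. Qed.

Lemma vol_ge0 n (A : set 'rV[R]_n) : (0 <= vol A)%E.
Proof. by apply: iint_ge0 => x; exact: indic_ge0. Qed.

Lemma vol_set0 n : vol (set0 : set 'rV[R]_n) = 0%E.
Proof. by rewrite /vol; under eq_fun do rewrite indic0; rewrite iint0. Qed.

Lemma vol_translate n (A : set 'rV[R]_n) (b : 'rV[R]_n) : row_mset A ->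
  vol [set x | A (x + b)] = vol A.
Proof.
move=> mA; rewrite /vol -(iint_translate b 0 (row_mset_indic mA))//.
Qed.

Lemma row_mset_mul n (A : set 'rV[R]_n) (M : 'M[R]_n) (b : 'rV[R]_n) :
  row_mset A -> row_mset [set x | A (x *m M + b)].
Proof.
move=> mA; have /measurable_EFinP m1 := row_measurable_mulmx M b (row_mset_indic mA).
have := m1 measurableT [set 1] (measurable_set1 _); rewrite setTI.
suff -> : (fun t => \1_A (@row_of_tuple n t *m M + b)) @^-1` [set 1 : R] =
  (@row_of_tuple n) @^-1` [set x : 'rV[R]_n | A (x *m M + b)] by [].
apply/seteqP; split => x /=; rewrite indicE.
  by case: (boolP (_ \in A)) => [/set_mem//|_ /eqP]; rewrite eq_sym oner_eq0.
by move=> ?; rewrite mem_set.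
Qed.

Lemma vol_affine n (M : 'M[R]_n) : M \in unitmx ->
  exists2 c : R, 0 <= c & forall (A : set 'rV[R]_n) (b : 'rV[R]_n), row_mset A ->
    (vol A = c%:E * vol [set x | A (x *m M + b)%R])%E.
Proof.
move=> /iint_linear[c c0 cE]; exists c => // A b mA.
rewrite -(vol_translate b mA) /vol cE//.
apply: row_mset_indic.
rewrite (_ : [set x | _] = [set x | A (x *m 1%:M + b)]).
  exact: row_mset_mul.
by apply/seteqP; split => x /=; rewrite mulmx1.
Qed.

Lemma vol_diag n (d : 'rV[R]_n) (A : set 'rV[R]_n) : (forall j, 0 < d ord0 j) ->
  row_mset A ->
  (vol A = (\prod_j d ord0 j)%:E * vol [set x | A (x *m diag_mx d)%R])%E.
Proof.
move=> d0 mA; rewrite /vol (iint_lower (M := diag_mx d) 0 (row_mset_indic mA))//.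
- congr (_%:E * _)%E; apply: eq_bigr => j _.
  by rewrite mxE eqxx mulr1n ger0_norm// ltW.
- by move=> j; rewrite mxE eqxx mulr1n gt_eqF.
- by move=> k j kj; rewrite mxE -val_eqE/= ltn_eqF.
Qed.

(** Integrate innermost along a coordinate [j] on which [a] is nonzero: every slice is a single
    point. *)
Lemma vol_hyperplane n (c : R) (a : 'rV[R]_n) : a != 0 ->
  vol [set x : 'rV[R]_n | c + dotp x a = 0] = 0%E.
Proof.
move=> a0; have [j aj] : exists j, a ord0 j != 0.
  apply/existsP; apply: contra_neqT a0 => /existsPn h.
  by apply/rowP => j; rewrite mxE; apply/eqP/negPn/h.
pose A := [set x : 'rV[R]_n | c + dotp x a = 0].
have mA : row_mset A by exact: row_mset_eq.
rewrite /vol (@iint_last n _ (fun=> 0%E) j 0 0) ?mul0e//.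
- exact: row_mset_indic.
- exact: row_measurable_cst.
move=> x; rewrite mul0e /Int.
pose t0 := - (c + \sum_(k | k != j) x ord0 k * a ord0 k) / a ord0 j.
have E t : A (upd x j t) <-> t = t0.
  rewrite /A /= /dotp (bigD1 j)//= !mxE eqxx.
  rewrite (eq_bigr (fun k => x ord0 k * a ord0 k)); last first.
    by move=> k kj; rewrite mxE ifN.
  rewrite /t0; set S := \sum_(_ | _) _; split => [h|->].
    by apply/(canRL (mulfK aj)); rewrite -[RHS]addr0 -h; ring.
  by rewrite divfK//; ring.
transitivity (\int[mu]_t (\1_[set t0] t)%:E)%E.
  apply: eq_integral => t _; congr (_%:E); rewrite !indicE; congr (_%:R); congr nat_of_bool.
  by apply/idP/idP => /set_mem h; apply/mem_set; apply/E.
transitivity (mu [set t0]); first by rewrite integral_indic// setIT.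
exact: lebesgue_measure_set1.
Qed.

Lemma vol_le n (A B : set 'rV[R]_n) : row_mset A -> row_mset B ->
  A `<=` B -> (vol A <= vol B)%E.
Proof.
move=> mA mB AB; apply: le_iint => //; try exact: row_mset_indic.
move=> x; rewrite lee_fin !indicE ler_nat.
by case: (boolP (x \in A)) => // /set_mem/AB/mem_set ->.
Qed.

Lemma vol_null n (A B : set 'rV[R]_n) : row_mset A -> row_mset B ->
  A `<=` B -> vol B = 0%E -> vol A = 0%E.
Proof.
move=> mA mB AB B0; apply/eqP; rewrite eq_le vol_ge0 andbT -B0.
exact: vol_le.
Qed.

(** The upper half of a sandwich whose lower half is [vol_pack]; with both, the null set where cells
    touch never has to be described. *)
Lemma vol_cover n (I : finType) (A : set 'rV[R]_n) (B : I -> set 'rV[R]_n) :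
  row_mset A -> (forall i, row_mset (B i)) ->
  (forall x, A x -> exists i, B i x) -> (vol A <= \sum_i vol (B i))%E.
Proof.
move=> mA mB AB; rewrite /vol -iint_sum//; last by move=> i; exact: row_mset_indic.
apply: le_iint => //; first exact: row_mset_indic.
  by apply: row_measurable_sum => i; exact: row_mset_indic.
move=> x; rewrite sumEFin lee_fin indicE.
case: (boolP (x \in A)) => [/set_mem/AB[i Bi]|_]; last by apply: sumr_ge0.
by rewrite (bigD1 i)//= indicE mem_set//= lerDl; apply: sumr_ge0.
Qed.

Lemma vol_pack n (I : finType) (P : pred I) (A : set 'rV[R]_n)
    (B : I -> set 'rV[R]_n) :
  row_mset A -> (forall i, P i -> row_mset (B i)) ->
  (forall i x, P i -> B i x -> A x) ->
  (forall i j x, P i -> P j -> B i x -> B j x -> i = j) ->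
  (\sum_(i | P i) vol (B i) <= vol A)%E.
Proof.
move=> mA mB BA Bd; rewrite big_mkcond /=.
pose C i := if P i then B i else set0.
have mC i : row_mset (C i).
  by rewrite /C; case: ifP => [/mB//|_]; exact: row_mset0.
rewrite (eq_bigr (fun i => vol (C i))); last first.
  by move=> i _; rewrite /C; case: ifP => //; rewrite vol_set0.
rewrite /vol -iint_sum//; last by move=> i; exact: row_mset_indic.
apply: le_iint => //; first by apply: row_measurable_sum => i; exact: row_mset_indic.
  exact: row_mset_indic.
  by move=> x; apply: sume_ge0.
move=> x; rewrite sumEFin lee_fin.
have CP i y : C i y -> P i /\ B i y by rewrite /C; case: ifP.
have [[i Ci]|/forallNP h] := pselect (exists i, C i x); last first.
  by rewrite big1// => i _; rewrite indicE memNset//; exact: h.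
have [Pi Bi] := CP _ _ Ci.
rewrite (bigD1 i)//= big1 ?addr0.
  by rewrite !indicE !mem_set//; exact: BA Bi.
move=> j ji; rewrite indicE memNset// => /CP[Pj Bj].
by move/eqP: ji; apply; exact: Bd Bj Bi.
Qed.

Lemma vol_split n (A B : set 'rV[R]_n) : row_mset A -> row_mset B -> A `<=` B ->
  (vol B = vol A + vol (B `\` A))%E.
Proof.
move=> mA mB AB; rewrite /vol -iintD//; try exact: row_mset_indic.
  congr (iint n _ 0); apply/funext => x; rewrite -EFinD; congr EFin.
  rewrite !indicE in_setD; case: (boolP (x \in A)) => [/set_mem/AB/mem_set ->|_] /=.
    by rewrite addr0.
  by rewrite add0r andbT.
by apply: row_mset_indic; exact: row_msetD.
Qed.

(** Its purpose is finiteness: the model cells with unit weights lie in the unit box. *)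
Lemma vol_unit_box n (A : set 'rV[R]_n) : row_mset A ->
  (forall x, A x -> forall j, 0 <= x ord0 j <= 1) -> (vol A <= 1)%E.
Proof.
move=> mA Abox.
(* After [k] integrations the value is at most the indicator that the remaining coordinates lie in
   [0, 1]. *)
suff H k v : (k <= n)%N -> (iint k (fun x => (\1_A x)%:E) v <=
    (if [forall j : 'I_n, (k <= j)%N ==> (0 <= v ord0 j <= 1)%R]
     then 1 else 0)%:E)%E.
  by apply: le_trans (H n 0 (leqnn n)) _; rewrite lee_fin; case: ifP.
elim: k v => [|k IH] v.
  rewrite /= lee_fin indicE; case: (boolP (v \in A)) => [/set_mem/Abox h _|_ _].
    by case: ifP => // /negP[]; apply/forallP => j; exact: h.
  by case: ifP.
move=> kn; rewrite /=; set c : bool := [forall j, _].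
apply: (@le_trans _ _ (\int[mu]_t ((if c then 1 else 0)%:E *
    (\1_`[0%R, 1%R] t)%:E))%E); last first.
  rewrite ge0_integralZl//; last by rewrite lee_fin; case: ifP.
  + have -> : (\int[mu]_t (\1_`[0%R, 1%R] t)%:E = 1)%E.
      transitivity (mu `[0%R, 1%R]%classic).
        by rewrite integral_indic// setIT.
      by rewrite lebesgue_measure_itv/= lte_fin ltr01 oppr0 adde0.
    by rewrite mule1.
  + by apply/measurable_EFinP; exact: measurable_indic.
apply: ge0_le_integral => //.
- by move=> *; apply: iint_ge0 => ?; exact: indic_ge0.
- apply: (measurable_upd k v); apply: row_measurable_iint => //.
  exact: row_mset_indic.
- apply: measurable_funeM; apply/measurable_EFinP; exact: measurable_indic.
move=> t _; apply: le_trans (IH _ (ltnW kn)) _; rewrite -EFinM lee_fin.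
case: ifPn => [/forallP h|_]; last by rewrite mulr_ge0//; case: ifP.
have -> : c.
  apply/forallP => j; apply/implyP => kj.
  by have := h j; rewrite !mxE (ltnW kj) gtn_eqF.
rewrite mul1r; have := h (Ordinal kn); rewrite !mxE/= leqnn eqxx /= => tb.
by rewrite indicE mem_set//= in_itv.
Qed.

End IteratedIntegral.

(** * Linear programming *)

Section LinearProgramming.
Variable R : realType.

Lemma dotpDl n (x y a : 'rV[R]_n) : dotp (x + y) a = dotp x a + dotp y a.
Proof.
by rewrite /dotp -big_split; apply: eq_bigr => j _; rewrite mxE mulrDl.
Qed.

Lemma dotpZl n (c : R) (x a : 'rV[R]_n) : dotp (c *: x) a = c * dotp x a.
Proof.
by rewrite /dotp mulr_sumr; apply: eq_bigr => j _; rewrite mxE mulrA.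
Qed.

Lemma dotpC n (x a : 'rV[R]_n) : dotp x a = dotp a x.
Proof. by apply: eq_bigr => j _; rewrite mulrC. Qed.

Lemma dotpDr n (x a b : 'rV[R]_n) : dotp x (a + b) = dotp x a + dotp x b.
Proof. by rewrite dotpC dotpDl !(dotpC x). Qed.

Lemma dotpZr n (c : R) (x a : 'rV[R]_n) : dotp x (c *: a) = c * dotp x a.
Proof. by rewrite dotpC dotpZl dotpC. Qed.

Lemma dotpNr n (x a : 'rV[R]_n) : dotp x (- a) = - dotp x a.
Proof. by rewrite -scaleN1r dotpZr mulN1r. Qed.

Lemma dotpNl n (x a : 'rV[R]_n) : dotp (- x) a = - dotp x a.
Proof. by rewrite -scaleN1r dotpZl mulN1r. Qed.

Lemma dotpBl n (x y a : 'rV[R]_n) : dotp (x - y) a = dotp x a - dotp y a.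
Proof. by rewrite dotpDl dotpNl. Qed.

Lemma dotp0l n (a : 'rV[R]_n) : dotp 0 a = 0.
Proof. by rewrite -(scale0r 0) dotpZl mul0r. Qed.

Lemma dotp0r n (a : 'rV[R]_n) : dotp a 0 = 0.
Proof. by rewrite dotpC dotp0l. Qed.

Lemma dotp_suml n (I : Type) (s : seq I) (P : pred I) (x : I -> 'rV[R]_n) a :
  dotp (\sum_(i <- s | P i) x i) a = \sum_(i <- s | P i) dotp (x i) a.
Proof.
apply: (big_morph (fun x => dotp x a)) => [y z|]; first exact: dotpDl.
exact: dotp0l.
Qed.

Lemma dotp_ge0 n (x : 'rV[R]_n) : 0 <= dotp x x.
Proof. by apply: sumr_ge0 => j _; rewrite -expr2 sqr_ge0. Qed.

Lemma dotp_eq0 n (x : 'rV[R]_n) : dotp x x = 0 -> x = 0.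
Proof.
move=> /eqP; rewrite psumr_eq0 => [/allP h|j _]; last by rewrite -expr2 sqr_ge0.
apply/rowP => j; rewrite mxE; have := h j (mem_index_enum _).
by rewrite -expr2 sqrf_eq0 => /eqP.
Qed.

Lemma dotp_delta n (x : 'rV[R]_n) j : dotp x (delta_mx 0 j) = x ord0 j.
Proof.
rewrite /dotp (bigD1 j)//= mxE !eqxx mulr1 big1 ?addr0// => k kj.
by rewrite mxE eqxx (negPf kj) mulr0.
Qed.

Lemma dotp_row_mx n m (x : 'rV[R]_n) (y : 'rV[R]_m) (a : 'rV[R]_n) (b : 'rV[R]_m) :
  dotp (row_mx x y) (row_mx a b) = dotp x a + dotp y b.
Proof.
rewrite /dotp big_split_ord /=; congr (_ + _); apply: eq_bigr => j _.
  by rewrite !row_mxEl.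
by rewrite !row_mxEr.
Qed.

(* Bartl's induction: if dropping the last vector loses the implication,
   eliminate it along a witness of the failure. *)
Lemma farkas_nat m N (a : nat -> 'rV[R]_m) (y : 'rV[R]_m) :
  (forall al, (forall i, (i < N)%N -> 0 <= dotp (a i) al) -> 0 <= dotp y al) ->
  exists2 w : nat -> R, (forall i, 0 <= w i) & y = \sum_(i < N) w i *: a i.
Proof.
elim: N a y => [|N IH] a y H.
  exists (fun=> 0) => //; rewrite big_ord0; apply: dotp_eq0; apply/eqP.
  rewrite eq_le dotp_ge0 andbT.
  by have := H (- y) (fun _ h => ltac:(by [])); rewrite dotpNr oppr_ge0.
have [H'|] := pselect (forall al, (forall i, (i < N)%N -> 0 <= dotp (a i) al) ->
    0 <= dotp y al).
  have [w w0 ->] := IH a y H'.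
  exists (fun i => if (i < N)%N then w i else 0) => [i|]; first by case: ifP.
  rewrite big_ord_recr /= ltnn scale0r addr0; apply: eq_bigr => i _.
  by rewrite ltn_ord.
move=> /existsNP[xb] /not_implyP[ax] /negP; rewrite -ltNge => yx.
have aN : dotp (a N) xb < 0.
  rewrite ltNge; apply/negP => aN; move: yx; rewrite ltNge => /negP; apply.
  by apply: H => i; rewrite ltnS leq_eqVlt => /predU1P[->|/ax].
have aN0 : dotp (a N) xb != 0 by rewrite lt_eqF.
pose pr (u : 'rV[R]_m) := u - (dotp u xb / dotp (a N) xb) *: a N.
have prE u al : dotp (pr u) al =
    dotp u (al - (dotp (a N) al / dotp (a N) xb) *: xb).
  by rewrite /pr dotpBl dotpZl dotpDr dotpNr dotpZr; field.
have [al al0|w w0 yw] := IH (fun i => pr (a i)) (pr y).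
  rewrite prE; apply: H => i; rewrite ltnS leq_eqVlt => /predU1P[->|iN].
    by rewrite dotpDr dotpNr dotpZr divfK// subrr.
  by rewrite -prE; exact: al0.
pose S := \sum_(i < N) w i * dotp (a i) xb.
have S0 : 0 <= S by apply: sumr_ge0 => i _; rewrite mulr_ge0// ax.
exists (fun i => if (i < N)%N then w i else (dotp y xb - S) / dotp (a N) xb).
  move=> i; case: ifP => // _; rewrite -mulrNN -invrN divr_ge0//.
    by rewrite oppr_ge0 subr_le0 (le_trans (ltW yx)).
  by rewrite oppr_ge0 ltW.
rewrite big_ord_recr /= ltnn.
under eq_bigr do rewrite ltn_ord.
rewrite -[LHS](subrK ((dotp y xb / dotp (a N) xb) *: a N)) -/(pr y) yw.
have -> : \sum_(i < N) w i *: pr (a i) =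
    \sum_(i < N) w i *: a i - (S / dotp (a N) xb) *: a N.
  rewrite /S mulr_suml scaler_suml -sumrB; apply: eq_bigr => i _.
  by rewrite /pr scalerBr scalerA mulrA.
rewrite -addrA; congr (_ + _).
by rewrite -scaleNr -scalerDl addrC -mulrBl.
Qed.

Section Cone.
Variables (I : finType) (m : nat) (a : I -> 'rV[R]_m).

Definition comb (w : I -> R) := \sum_b w b *: a b.

Lemma comb_scaleD (w z : I -> R) t :
  comb (fun b => w b + t * z b) = comb w + t *: comb z.
Proof.
rewrite /comb scaler_sumr -big_split /=; apply: eq_bigr => b _.
by rewrite scalerDl scalerA.
Qed.

Lemma farkas (y : 'rV[R]_m) :
  (forall al, (forall b, 0 <= dotp (a b) al) -> 0 <= dotp y al) ->
  exists2 w : I -> R, (forall b, 0 <= w b) & y = comb w.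
Proof.
move=> H; have [al al0|w w0 yw] :=
    @farkas_nat m #|I| (fun i => nth 0 [seq a b | b <- enum I] i) y.
  apply: H => b; have := al0 (enum_rank b) (ltn_ord _).
  by rewrite (nth_map b) ?nth_enum_rank// -cardE ltn_ord.
exists (fun b => w (enum_rank b)) => //; rewrite yw /comb.
rewrite (reindex (@enum_rank I))/=; last exact: onW_bij (enum_rank_bij I).
apply: eq_bigr => b _; congr (_ *: _).
by rewrite (nth_map b) ?nth_enum_rank// -cardE ltn_ord.
Qed.

Definition indep (J : {set I}) := forall z : I -> R,
  (forall b, b \notin J -> z b = 0) -> comb z = 0 -> forall b, z b = 0.

(** Spanning, stated as triviality of the orthogonal complement, the form that Farkas's lemma
    converts into coefficients ([full_span]). *)
Definition full (J : {set I}) := forall al : 'rV[R]_m,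
  (forall b, b \in J -> dotp (a b) al = 0) -> al = 0.

Lemma indep_inj (J : {set I}) (w v : I -> R) : indep J ->
  (forall b, b \notin J -> w b = 0) -> (forall b, b \notin J -> v b = 0) ->
  comb w = comb v -> w = v.
Proof.
move=> iJ wJ vJ wv; apply/funext => b; apply/eqP; rewrite -subr_eq0; apply/eqP.
rewrite -[- v b]mulN1r; apply: (iJ (fun b => w b + (-1) * v b)) => [d dJ|].
  by rewrite wJ// vJ// mulr0 addr0.
by rewrite comb_scaleD wv scaleN1r subrr.
Qed.

End Cone.

(** A linear span is the cone on the vectors and their opposites, so Farkas's lemma applies. *)
Lemma span_dual (I : finType) m (a : I -> 'rV[R]_m) (J : {set I}) y :
  (forall al, (forall b, b \in J -> dotp (a b) al = 0) -> dotp y al = 0) ->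
  exists2 z : I -> R, (forall b, b \notin J -> z b = 0) & y = comb a z.
Proof.
move=> H.
pose v (t : I * bool) := if t.1 \in J then (-1) ^+ t.2 *: a t.1 else 0.
have [al h|w w0 ->] := @farkas _ _ v y.
  rewrite H// => b bJ; apply/eqP; rewrite eq_le.
  have := h (b, true); have := h (b, false).
  by rewrite /v /= bJ !dotpZl expr0 expr1 mul1r mulN1r oppr_ge0 => -> ->.
exists (fun b => if b \in J then w (b, false) - w (b, true) else 0).
  by move=> b /negPf ->.
transitivity (\sum_b \sum_s w (b, s) *: v (b, s)).
  by rewrite pair_bigA /comb; apply: eq_bigr => -[].
apply: eq_bigr => b _; rewrite big_bool /v /=; case: ifP => _.
  by rewrite expr0 expr1 scale1r scaleN1r scalerN scalerBl addrC.
by rewrite !scaler0 scale0r addr0.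
Qed.

Lemma full_span (I : finType) m (a : I -> 'rV[R]_m) (J : {set I}) y :
  full a J -> exists2 z : I -> R, (forall b, b \notin J -> z b = 0) & y = comb a z.
Proof. by move=> fJ; apply: span_dual => al /fJ ->; exact: dotp0r. Qed.

(** Solvability of this linear system is [span_dual] for the columns: an obstruction would be a
    linear relation among the vectors of [J]. *)
Lemma indep_interpolate (I : finType) m (a : I -> 'rV[R]_m) (J : {set I})
    (c : I -> R) :
  indep a J -> exists al, forall b, b \in J -> dotp (a b) al = c b.
Proof.
move=> iJ.
pose v (j : 'I_m) : 'rV[R]_#|I| :=
  \row_k (if enum_val k \in J then a (enum_val k) ord0 j else 0).
pose y : 'rV[R]_#|I| := \row_k (if enum_val k \in J then c (enum_val k) else 0).
have [al h|z _ yz] := @span_dual _ _ v [set: 'I_m]%SET y; last first.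
  exists (\row_j z j) => b bJ.
  have /rowP/(_ (enum_rank b)) := yz; rewrite !mxE enum_rankK bJ => ->.
  rewrite /comb summxE /dotp; apply: eq_bigr => j _.
  by rewrite !mxE enum_rankK bJ mulrC.
pose z b := if b \in J then al ord0 (enum_rank b) else 0.
have z0 : forall b, z b = 0.
  apply: iJ => [b /negPf bJ|]; first by rewrite /z bJ.
  apply/rowP => j; rewrite [RHS]mxE -[RHS](h j)// ?inE// /comb summxE /dotp.
  rewrite (reindex (@enum_rank I))/=; last exact: onW_bij (enum_rank_bij I).
  apply: eq_bigr => b _; rewrite !mxE enum_rankK /z.
  by case: ifP => _; rewrite ?mul0r// mulrC.
rewrite /dotp big1// => k _; rewrite mxE; case: ifP => kJ; rewrite ?mul0r//.
by have := z0 (enum_val k); rewrite /z kJ enum_valK => ->; rewrite mulr0.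
Qed.

(** * Optimal bases of a linear program with positive costs *)

Section Optimum.
Variables (I : finType) (m : nat) (a : I -> 'rV[R]_m) (c : I -> R).
Hypothesis c0 : forall b, 0 < c b.

Definition supp (w : I -> R) : {set I} := [set b | w b != 0].

Definition cost (w : I -> R) := \sum_b c b * w b.

Lemma cost_scaleD (w z : I -> R) t :
  cost (fun b => w b + t * z b) = cost w + t * cost z.
Proof.
rewrite /cost mulr_sumr -big_split /=; apply: eq_bigr => b _.
by rewrite mulrDr mulrCA.
Qed.

(* A kernel vector of nonpositive cost has a negative entry because all costs
   are positive, so one can move along it until the support shrinks. *)
Lemma pivot (w : I -> R) : (forall b, 0 <= w b) ->
  exists w', [/\ forall b, 0 <= w' b, comb a w' = comb a w,
    cost w' <= cost w & indep a (supp w')].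
Proof.
have [k] := ubnP #|supp w|; elim: k w => // k IH w; rewrite ltnS => wk w0.
have [iw|] := pselect (indep a (supp w)); first by exists w.
move=> /existsNP[z0] /not_implyP[zs] /not_implyP[za] /existsNP[b1 /eqP zb1].
wlog zc : z0 zs za zb1 / cost z0 <= 0.
  move=> H; have [|/ltW zc] := leP (cost z0) 0; first exact: H.
  apply: (H (fun b => 0 + (-1) * z0 b)) => [b /zs ->||/=|].
  - by rewrite mulr0 addr0.
  - rewrite comb_scaleD za scaler0 addr0 /comb big1// => b _.
    by rewrite scale0r.
  - by rewrite add0r mulN1r oppr_eq0.
  - rewrite cost_scaleD /cost big1 ?add0r ?mulN1r ?oppr_le0//.
    by move=> b _; rewrite mulr0.
have [b2 zb2] : exists b, z0 b < 0.
  apply/existsP; apply: contraTT zc => /existsPn h; rewrite -ltNge.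
  have z00 b : 0 <= z0 b by rewrite leNgt.
  rewrite /cost (bigD1 b1)//= ltr_pwDl//.
    by rewrite mulr_gt0// lt_def zb1 z00.
  by apply: sumr_ge0 => b _; rewrite mulr_ge0// ltW.
case: (@arg_minP _ _ I b2 (fun b => z0 b < 0) (fun b => w b / - z0 b) zb2).
move=> b3 zb3 b3min; pose t := w b3 / - z0 b3.
have t0 : 0 <= t by rewrite divr_ge0// oppr_ge0 ltW.
pose w' b := w b + t * z0 b.
have w'0 b : 0 <= w' b.
  have [zb|zb] := leP 0 (z0 b); first by rewrite addr_ge0// mulr_ge0.
  rewrite /w' -[z0 b]opprK mulrN subr_ge0 -ler_pdivlMr ?oppr_gt0//.
  exact: b3min.
have w'b3 : w' b3 = 0.
  by rewrite /w' /t invrN mulrN mulNr divfK ?subrr// lt_eqF.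
have sub : supp w' \proper supp w.
  apply/properP; split.
    apply/fintype.subsetP => b; rewrite !inE; apply: contraNN => /eqP wb.
    by rewrite /w' wb zs ?inE ?wb ?eqxx// mulr0 addr0.
  exists b3; last by rewrite inE w'b3 eqxx.
  by apply: contraTT zb3 => /zs ->; rewrite ltxx.
have [w'' [h1 h2 h3 h4]] := IH w' (leq_trans (proper_card sub) wk) w'0.
exists w''; split => //.
  by rewrite h2 comb_scaleD za scaler0 addr0.
by rewrite (le_trans h3)// cost_scaleD gerDl mulr_ge0_le0.
Qed.

(** Only finitely many supports are independent and each carries at most one solution, so a cheapest
    basic solution exists; by [pivot] it costs no more than any feasible [v]. *)
Lemma optimum (w : I -> R) : (forall b, 0 <= w b) ->
  exists w', [/\ forall b, 0 <= w' b, comb a w' = comb a w, indep a (supp w')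
    & forall v, (forall b, 0 <= v b) -> comb a v = comb a w ->
        cost w' <= cost v].
Proof.
move=> w0.
pose Q (J : {set I}) v := [/\ forall b, 0 <= v b, comb a v = comb a w,
  indep a J & supp v = J].
pose P (J : {set I}) := `[< exists v, Q J v >].
have [W WP] : {W : {set I} -> I -> R & forall J, P J -> Q J (W J)}.
  apply: (@boolp.choice _ _ (fun J v => P J -> Q J v)) => J.
  have [|nP] := boolP (P J); last by exists w.
  by move=> /asboolP[v Qv]; exists v.
have [w1 [h1 h2 h3 h4]] := pivot w0.
have PJ v : (forall b, 0 <= v b) -> comb a v = comb a w -> indep a (supp v) ->
    P (supp v) by move=> v0 va vi; apply/asboolP; exists v.
have := @arg_minP _ _ {set I} (supp w1) P (fun J => cost (W J)) (PJ _ h1 h2 h4).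
case=> J PJJ Jmin; have [g1 g2 g3 g4] := WP J PJJ.
exists (W J); split => //; first by rewrite g4.
move=> v v0 va; have [v1 [k1 k2 k3 k4]] := pivot v0.
apply: le_trans k3; have Pv := PJ _ k1 (etrans k2 va) k4.
have [e1 e2 e3 e4] := WP _ Pv.
suff -> : v1 = W (supp v1) by exact: Jmin.
apply: (indep_inj k4); first by move=> b; rewrite inE negbK => /eqP.
  by move=> b; rewrite -{1}e4 inE negbK => /eqP.
by rewrite k2 e2.
Qed.

(** An optimality certificate with strict slack off [B]. It refers to the vectors and costs only, so
    the same sets [B] serve every right-hand side. *)
Definition dual_feasible (B : {set I}) := exists al : 'rV[R]_m,
  (forall b, b \in B -> dotp (a b) al = c b) /\
  (forall b, b \notin B -> dotp (a b) al < c b).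

(** Weak duality: the cost difference is the slack weighted by [v], and equal costs force [v] to
    vanish where the slack is positive. *)
Lemma dual_feasible_subset (w v : I -> R) : (forall b, 0 <= v b) ->
  comb a w = comb a v -> dual_feasible (supp w) ->
  cost w <= cost v /\ (cost v <= cost w -> supp v \subset supp w).
Proof.
move=> v0 wv [al [alw alN]].
have cw : cost w = dotp (comb a v) al.
  rewrite -wv dotp_suml; apply: eq_bigr => b _; rewrite dotpZl mulrC.
  have [bw|] := boolP (b \in supp w); first by rewrite alw.
  by rewrite inE negbK => /eqP ->; rewrite !mul0r.
have le b : dotp (a b) al <= c b.
  by have [/alw ->//|/alN/ltW] := boolP (b \in supp w).
have D : cost v - cost w = \sum_b (c b - dotp (a b) al) * v b.
  rewrite cw dotp_suml -sumrB; apply: eq_bigr => b _.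
  by rewrite dotpZl mulrBl [v b * _]mulrC.
have D0 b : 0 <= (c b - dotp (a b) al) * v b by rewrite mulr_ge0// subr_ge0.
split; first by rewrite -subr_ge0 D sumr_ge0.
rewrite -subr_le0 D => S0; apply/fintype.subsetP => b; rewrite inE => vb.
apply: contraT => /alN; rewrite -subr_gt0 => lt.
have : 0 < \sum_b (c b - dotp (a b) al) * v b.
  rewrite (bigD1 b)//= ltr_pwDl ?sumr_ge0// mulr_gt0// lt_def vb.
  exact: v0.
by rewrite ltNge S0.
Qed.

Lemma dual_feasible_uniq (w v : I -> R) : (forall b, 0 <= w b) ->
  (forall b, 0 <= v b) -> comb a w = comb a v ->
  dual_feasible (supp w) -> dual_feasible (supp v) -> supp w = supp v.
Proof.
move=> w0 v0 wv dw dv.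
have [h1 h2] := dual_feasible_subset v0 wv dw.
have [h3 h4] := dual_feasible_subset w0 (esym wv) dv.
by apply/eqP; rewrite finset.eqEsubset h2// h4.
Qed.

(** [z] is the relation expressing the vector [k] through [B], and its cost is the reduced cost of
    [k]; no reduced cost may vanish. *)
Definition generic := forall (B : {set I}) k (z : I -> R), indep a B ->
  k \notin B -> z k = 1 -> (forall b, b \notin B -> b != k -> z b = 0) ->
  comb a z = 0 -> cost z != 0.

Lemma optimum_generic (w : I -> R) : generic -> (forall b, 0 <= w b) ->
  exists w', [/\ forall b, 0 <= w' b, comb a w' = comb a w, indep a (supp w')
    & full a (supp w') -> dual_feasible (supp w')].
Proof.
move=> gen w0; have [w' [h1 h2 h3 h4]] := optimum w0.
exists w'; split => // fB; set B := supp w' in h3 fB *.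
have [al alB] := indep_interpolate c h3.
exists al; split => // k kB.
have [z zB az] := full_span (a k) fB.
have dk : dotp (a k) al = cost z.
  rewrite az dotp_suml; apply: eq_bigr => b _; rewrite dotpZl mulrC.
  have [bB|/zB ->] := boolP (b \in B); first by rewrite alB.
  by rewrite !mulr0.
(* The direction that brings [k] into the basis. Its cost is the reduced cost of [k], which
   optimality makes nonnegative and genericity nonzero. *)
pose v b := (b == k)%:R - z b.
have vE : v = (fun b => (b == k)%:R + (-1) * z b).
  by apply/funext => b; rewrite mulN1r.
have ak : comb a (fun b => (b == k)%:R) = a k.
  rewrite /comb (bigD1 k)//= eqxx scale1r big1 ?addr0// => b /negPf ->.
  by rewrite scale0r.
have ck : cost (fun b => (b == k)%:R) = c k.
  rewrite /cost (bigD1 k)//= eqxx mulr1 big1 ?addr0// => b /negPf ->.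
  by rewrite mulr0.
have cv : cost v = c k - cost z by rewrite vE cost_scaleD ck mulN1r.
have av : comb a v = 0 by rewrite vE comb_scaleD ak -az scaleN1r subrr.
have v0 : cost v != 0.
  apply: (gen B k) => //; first by rewrite /v eqxx zB// subr0.
  by move=> b bB /negPf bk; rewrite /v bk zB// subr0.
rewrite dk -subr_gt0 -cv lt_def v0 /=.
(* A step of length d / S keeps the weights nonnegative: [d] bounds the basic weights from below
   (the 1 covers an empty basis) and [S] exceeds every |z b|. *)
pose d := \big[Num.min/1]_(b in B) w' b.
have d0 : 0 < d.
  rewrite /d; elim/big_ind: _ => // [x y x0 y0|b]; first by rewrite lt_min x0.
  by rewrite inE => wb; rewrite lt_def wb h1.
have dle b : b \in B -> d <= w' b by move=> bB; rewrite /d (bigD1 b)//= ge_min lexx.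
pose S := 1 + \sum_b `|z b|.
have S0 : 0 < S by rewrite ltr_pwDl// sumr_ge0.
have t0 : 0 < d / S by rewrite divr_gt0.
have := h4 (fun b => w' b + (d / S) * v b).
rewrite cost_scaleD lerDl pmulr_rge0// comb_scaleD av scaler0 addr0; apply => //.
move=> b; have [->|bk] := eqVneq b k.
  by rewrite /v eqxx zB// subr0 mulr1 addr_ge0// ltW.
rewrite /v (negPf bk) sub0r mulrN subr_ge0.
have [bB|/zB ->] := boolP (b \in B); last by rewrite mulr0.
apply: le_trans (dle _ bB); rewrite mulrAC ler_pdivrMr// ler_pM2l//.
rewrite (le_trans (ler_norm _))// /S (bigD1 b)//=.
by rewrite addrCA lerDl addr_ge0// sumr_ge0.
Qed.
End Optimum.

(** * Existence of generic costs *)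

Lemma poly_nonroot_nat (q : {poly R}) : q != 0 -> exists k : nat, q.[k.+1%:R] != 0.
Proof.
move=> q0; apply: contrapT => /forallNP h.
pose rs := [seq (i.+1%:R : R) | i <- iota 0 (size q)].
have rsq : all (root q) rs.
  by apply/seq.allP => _ /mapP[i _ ->]; apply/negPn/negP/h.
have urs : uniq rs.
  by rewrite map_inj_uniq ?iota_uniq// => i j /eqP; rewrite eqr_nat eqSS => /eqP.
by have := max_poly_roots q0 rsq urs; rewrite size_map size_iota ltnn.
Qed.

(** The costs are distinct powers of one integer x: each nonzero vector gives a nonzero polynomial
    in x, and a positive integer avoids the roots of their product. *)
Lemma generic_avoid (I T : finType) (ze : T -> I -> R) :
  exists2 c : I -> R, (forall b, 0 < c b) &
    forall t, (exists b, ze t b != 0) -> cost c (ze t) != 0.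
Proof.
pose p t : {poly R} := \sum_b ze t b *: 'X^(enum_rank b).
pose q := \prod_(t | p t != 0) p t.
have q0 : q != 0 by apply/prodf_neq0.
have [k qk] := poly_nonroot_nat q0.
exists (fun b => k.+1%:R ^+ enum_rank b) => [b|t [b zb]].
  by rewrite exprn_gt0.
have -> : cost (fun b => k.+1%:R ^+ enum_rank b) (ze t) = (p t).[k.+1%:R].
  rewrite /p horner_sum; apply: eq_bigr => d _.
  by rewrite hornerZ hornerXn mulrC.
have pt : p t != 0.
  apply: contra zb => /eqP/polyP/(_ (enum_rank b)); rewrite coef0 coef_sum.
  rewrite (bigD1 b)//= coefZ coefXn eqxx mulr1 big1 ?addr0 => [->//|d db].
  rewrite coefZ coefXn (inj_eq val_inj) (inj_eq enum_rank_inj) eq_sym.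
  by rewrite (negPf db) mulr0.
by move: qk; rewrite horner_prod prodf_seq_neq0 => /allP/(_ t (mem_index_enum _));
  rewrite pt.
Qed.

(** For [B] independent the relation expressing [k] is unique, so genericity amounts to avoiding the
    finitely many vectors [ze (B, k)]. *)
Lemma generic_exists (I : finType) m (a : I -> 'rV[R]_m) :
  exists2 c : I -> R, (forall b, 0 < c b) & generic a c.
Proof.
pose Q (t : {set I} * I) (z : I -> R) := [/\ z t.2 = 1,
  forall b, b \notin t.1 -> b != t.2 -> z b = 0 & comb a z = 0].
have [ze zeP] : {ze : {set I} * I -> I -> R &
    forall t, (exists z, Q t z) -> Q t (ze t)}.
  apply: (@boolp.choice _ _ (fun t z => (exists z, Q t z) -> Q t z)) => t.
  have [[z Qz]|n] := pselect (exists z, Q t z); first by exists z.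
  by exists (fun=> 0).
have [c c0 cP] := generic_avoid ze.
exists c => // B k z iB kB zk zB az.
have [h1 h2 h3] := zeP (B, k) (ex_intro _ z (And3 zk zB az)).
have iz : (fun b => ze (B, k) b + (-1) * z b) = fun=> 0.
  apply/funext; apply: iB => [b bB|]; last by rewrite comb_scaleD h3 az scaler0 addr0.
  have [->|bk] := eqVneq b k; first by rewrite h1 zk mulN1r subrr.
  by rewrite h2// zB// mulr0 addr0.
suff -> : z = ze (B, k) by apply: cP; exists k; rewrite h1 oner_eq0.
apply/funext => b; have /(congr1 (fun f => f b)) /= := iz.
by rewrite mulN1r => /eqP; rewrite subr_eq0 => /eqP.
Qed.

End LinearProgramming.

(** * Cell decomposition of Minkowski sums *)

Section Cells.
Variable R : realType.

Definition is_affine n (g : 'rV[R]_n -> R) :=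
  exists (c : R) (u : 'I_n -> R), forall x, g x = c + \sum_j x ord0 j * u j.

Lemma is_affine_cst n (c : R) : is_affine (fun _ : 'rV[R]_n => c).
Proof.
by exists c, (fun=> 0) => x; rewrite big1 ?addr0// => j _; rewrite mulr0.
Qed.

Lemma is_affine_dotp n (al : 'rV[R]_n) : is_affine (fun x => dotp x al).
Proof. by exists 0, (fun j => al ord0 j) => x; rewrite add0r. Qed.

Lemma is_affine_coord n (j : 'I_n) : is_affine (fun x : 'rV[R]_n => x ord0 j).
Proof.
have := @is_affine_dotp n (delta_mx 0 j); congr is_affine.
by apply/funext => x; rewrite dotp_delta.
Qed.

Lemma is_affineD n (g h : 'rV[R]_n -> R) : is_affine g -> is_affine h ->
  is_affine (fun x => g x + h x).
Proof.
move=> [c [u gE]] [d [v hE]]; exists (c + d), (fun j => u j + v j) => x.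
by rewrite gE hE addrACA -big_split /=; congr (_ + _); apply: eq_bigr => j _; rewrite mulrDr.
Qed.

Lemma is_affineZ n (g : 'rV[R]_n -> R) t : is_affine g ->
  is_affine (fun x => t * g x).
Proof.
move=> [c [u gE]]; exists (t * c), (fun j => t * u j) => x.
rewrite gE mulrDr mulr_sumr; congr (_ + _).
by apply: eq_bigr => j _; rewrite mulrCA.
Qed.

Lemma is_affine_sum n (I : Type) (s : seq I) (g : I -> 'rV[R]_n -> R) :
  (forall i, is_affine (g i)) -> is_affine (fun x => \sum_(i <- s) g i x).
Proof.
move=> gA; elim: s => [|i s IH].
  by under eq_fun do rewrite big_nil; exact: is_affine_cst.
by under eq_fun do rewrite big_cons; exact: is_affineD.
Qed.

Lemma row_mset_affine_ge n (g : 'rV[R]_n -> R) : is_affine g ->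
  row_mset [set x | 0 <= g x].
Proof.
by move=> [c [u gE]]; under eq_set do rewrite gE; exact: row_mset_le.
Qed.

Lemma row_mset_affine_gt n (g : 'rV[R]_n -> R) : is_affine g ->
  row_mset [set x | 0 < g x].
Proof.
by move=> [c [u gE]]; under eq_set do rewrite gE; exact: row_mset_lt.
Qed.

Lemma row_mset_affine_eq0 n (g : 'rV[R]_n -> R) : is_affine g ->
  row_mset [set x | g x = 0].
Proof.
by move=> [c [u gE]]; under eq_set do rewrite gE; exact: row_mset_eq.
Qed.

Lemma row_mset_and n (P : Prop) (A : set 'rV[R]_n) :
  (P -> row_mset A) -> row_mset [set x | P /\ A x].
Proof.
have [p mA|np _] := pselect P.
  suff -> : [set x | P /\ A x] = A by exact: mA.
  by apply/seteqP; split => x; [case|split].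
suff -> : [set x | P /\ A x] = set0 by exact: row_mset0.
by apply/seteqP; split => x // [].
Qed.

Lemma row_mset_imply n (P : Prop) (A : set 'rV[R]_n) :
  (P -> row_mset A) -> row_mset [set x | P -> A x].
Proof.
have [p mA|np _] := pselect P.
  suff -> : [set x | P -> A x] = A by exact: mA.
  by apply/seteqP; split => x /=; [apply|].
suff -> : [set x | P -> A x] = setT by exact: row_msetT.
by apply/seteqP; split => // x _ /np.
Qed.

Variables (n : nat) (I : finType) (ka : I -> 'I_n) (p : I -> 'rV[R]_n).

(* The Cayley configuration: [w] is a conic combination of the Cayley vectors
   equal to [(lam, x)] iff [x] is a Minkowski combination with weights [lam]. *)
Definition cayley (b : I) : 'rV[R]_(n + n) := row_mx (delta_mx 0 (ka b)) (p b).

Definition row_fun (lam : 'I_n -> R) : 'rV[R]_n := \row_i lam i.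

Lemma comb_cayley (w : I -> R) : comb cayley w =
  row_mx (\row_i \sum_(b | ka b == i) w b) (\sum_b w b *: p b).
Proof.
rewrite /comb; apply/rowP => k; rewrite summxE.
case: (splitP k) => j kj.
  have -> : k = lshift n j by apply/val_inj.
  rewrite row_mxEl mxE [RHS]big_mkcond; apply: eq_bigr => b _.
  rewrite mxE row_mxEl mxE eqxx eq_sym.
  by case: eqP => _; rewrite ?mulr1 ?mulr0.
have -> : k = rshift n j by apply/val_inj.
rewrite row_mxEr summxE; apply: eq_bigr => b _.
by rewrite mxE row_mxEr mxE.
Qed.

Definition mink_sum (lam : 'I_n -> R) : set 'rV[R]_n :=
  [set x | exists2 w : I -> R, (forall b, 0 <= w b) &
     comb cayley w = row_mx (row_fun lam) x].

Definition closed_cell (J : {set I}) (lam : 'I_n -> R) : set 'rV[R]_n :=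
  [set x | exists w : I -> R, [/\ forall b, 0 <= w b,
     forall b, b \notin J -> w b = 0 & comb cayley w = row_mx (row_fun lam) x]].

(** Positivity on all of [B] makes the support exactly [B]; this is why cells of different dual
    feasible bases are disjoint. *)
Definition open_cell (B : {set I}) (lam : 'I_n -> R) : set 'rV[R]_n :=
  [set x | exists w : I -> R, [/\ forall b, b \in B -> 0 < w b,
     forall b, b \notin B -> w b = 0 & comb cayley w = row_mx (row_fun lam) x]].

(** Pairing with vectors dual to [J] reads off the weights as affine functions of [x]; cells are
    thus cut out by finitely many affine conditions and are measurable. *)
Lemma cell_weights (J : {set I}) (lam : 'I_n -> R) : indep cayley J ->
  exists W : I -> 'rV[R]_n -> R, [/\ forall b, is_affine (W b),
    forall b x, b \notin J -> W b x = 0 &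
    forall w x, (forall b, b \notin J -> w b = 0) ->
      comb cayley w = row_mx (row_fun lam) x -> forall b, w b = W b x].
Proof.
move=> iJ.
have [al alP] : {al : I -> 'rV[R]_(n + n) &
    forall d b, b \in J -> dotp (cayley b) (al d) = (b == d)%:R}.
  apply: (@boolp.choice _ _ (fun d al => forall b, b \in J ->
    dotp (cayley b) al = (b == d)%:R)) => d.
  by have [al h] := indep_interpolate (fun b => (b == d)%:R) iJ; exists al.
exists (fun b x => if b \in J then
   dotp (row_fun lam) (lsubmx (al b)) + dotp x (rsubmx (al b)) else 0); split.
- move=> b; case: (b \in J); last exact: is_affine_cst.
  by apply: is_affineD; [exact: is_affine_cst|exact: is_affine_dotp].
- by move=> b x /negPf ->.
move=> w x wJ wx b; case: ifPn => [bJ|/wJ//].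
rewrite -dotp_row_mx hsubmxK -wx dotp_suml (bigD1 b)//= big1 ?addr0.
  by rewrite dotpZl alP// eqxx mulr1.
move=> d db; rewrite dotpZl; have [dJ|/wJ ->] := boolP (d \in J); last by rewrite mul0r.
by rewrite alP// (negPf db) mulr0.
Qed.

Lemma affine_comb (W : I -> 'rV[R]_n -> R) (lam : 'I_n -> R) k :
  (forall b, is_affine (W b)) ->
  is_affine (fun x => comb cayley (W^~ x) ord0 k - row_mx (row_fun lam) x ord0 k).
Proof.
move=> WA; apply: is_affineD.
  under eq_fun do rewrite /comb summxE.
  apply: is_affine_sum => b; under eq_fun do rewrite mxE mulrC.
  exact: is_affineZ.
under eq_fun do rewrite -mulN1r; apply: is_affineZ.
case: (splitP k) => j kj.
  have -> : k = lshift n j by apply/val_inj.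
  by under eq_fun do rewrite row_mxEl; exact: is_affine_cst.
have -> : k = rshift n j by apply/val_inj.
by under eq_fun do rewrite row_mxEr; exact: is_affine_coord.
Qed.

Lemma row_mset_closed_cell (J : {set I}) lam : indep cayley J ->
  row_mset (closed_cell J lam).
Proof.
move=> /(cell_weights lam)[W [WA W0 WE]].
have -> : closed_cell J lam = [set x | forall b, 0 <= W b x] `&`
    [set x | forall k, comb cayley (W^~ x) ord0 k -
      row_mx (row_fun lam) x ord0 k = 0].
  apply/seteqP; split => [x [w [w0 wJ wx]]|x [h1 h2]].
    have e : w = W^~ x by apply/funext => b; exact: WE.
    split => /= [b|k]; first by rewrite -(WE w).
    by rewrite -e wx subrr.
  exists (W^~ x); split => // [b /W0 ->//|].
  by apply/rowP => k; apply/eqP; rewrite -subr_eq0; apply/eqP/h2.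
apply: row_msetI; apply: row_mset_forall => i.
  by apply: row_mset_affine_ge.
by apply: row_mset_affine_eq0; exact: affine_comb.
Qed.

Lemma row_mset_open_cell (B : {set I}) lam : indep cayley B ->
  row_mset (open_cell B lam).
Proof.
move=> /(cell_weights lam)[W [WA W0 WE]].
have -> : open_cell B lam = [set x | forall b, b \in B -> 0 < W b x] `&`
    [set x | forall k, comb cayley (W^~ x) ord0 k -
      row_mx (row_fun lam) x ord0 k = 0].
  apply/seteqP; split => [x [w [w0 wJ wx]]|x [h1 h2]].
    have e : w = W^~ x by apply/funext => b; exact: WE.
    split => /= [b bB|k]; first by rewrite -(WE w)//; exact: w0.
    by rewrite -e wx subrr.
  exists (W^~ x); split => // [b /W0 ->//|].
  by apply/rowP => k; apply/eqP; rewrite -subr_eq0; apply/eqP/h2.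
apply: row_msetI; apply: row_mset_forall => i.
  by apply: row_mset_imply => _; exact: row_mset_affine_gt.
by apply: row_mset_affine_eq0; exact: affine_comb.
Qed.

(** Caratheodory's theorem for cones, by [pivot] with unit costs; it exhibits the sum as a finite
    union of measurable cells. *)
Lemma mink_sum_cells lam :
  mink_sum lam = [set x | exists J : {set I}, (indep cayley J /\ closed_cell J lam x)].
Proof.
apply/seteqP; split => [x [w w0 wx]|x [J [_ [w [w0 _ wx]]]]]; last by exists w.
have [w' [h1 h2 _ h4]] := pivot cayley (c := fun=> 1) (fun=> ltr01) w0.
exists (supp w'); split => //; exists w'; split; rewrite ?h2//.
by move=> b; rewrite inE negbK => /eqP.
Qed.

Lemma row_mset_mink_sum lam : row_mset (mink_sum lam).
Proof.
rewrite mink_sum_cells; apply: row_mset_exists => J.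
by apply: row_mset_and => iJ; exact: row_mset_closed_cell.
Qed.

(** A nonzero vector (mu, be) orthogonal to the generators confines the cell to a hyperplane if be
    is nonzero. If be = 0, some colour is absent from [J], its total weight would be 0, and the cell
    is empty. *)
Lemma vol_closed_cell_not_full (J : {set I}) lam : (forall i, 0 < lam i) ->
  indep cayley J -> ~ full cayley J -> vol (closed_cell J lam) = 0%E.
Proof.
move=> lam0 iJ /existsNP[al] /not_implyP[alJ /eqP al0].
pose mu := lsubmx al; pose be := rsubmx al.
have E x : closed_cell J lam x -> dotp (row_fun lam) mu + dotp x be = 0.
  move=> [w [w0 wJ wx]]; rewrite -dotp_row_mx hsubmxK -wx dotp_suml big1// => b _.
  rewrite dotpZl; have [/alJ ->|/wJ ->] := boolP (b \in J); first by rewrite mulr0.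
  by rewrite mul0r.
have [be0|be0] := eqVneq be 0; last first.
  apply: vol_null (vol_hyperplane (dotp (row_fun lam) mu) be0).
  - exact: row_mset_closed_cell.
  - apply: row_mset_affine_eq0; apply: is_affineD; first exact: is_affine_cst.
    exact: is_affine_dotp.
  - exact: E.
rewrite (_ : closed_cell J lam = set0) ?vol_set0//.
apply/seteqP; split => // x [w [w0 wJ]]; rewrite comb_cayley => /eq_row_mx[wl _].
have [i mui] : exists i, mu ord0 i != 0.
  apply/existsP; apply: contraT => /existsPn h; exfalso; move/eqP: al0; apply.
  rewrite -[al]hsubmxK -/mu -/be be0 (_ : mu = 0) ?row_mx0//.
  by apply/rowP => i; rewrite [RHS]mxE; apply/eqP/negPn/h.
have := lam0 i; have /rowP/(_ i) := wl; rewrite !mxE => <-.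
rewrite big1 ?ltxx// => b /eqP bi; apply: wJ; apply: contra mui => /alJ.
rewrite -[al]hsubmxK -/mu -/be be0 /cayley dotp_row_mx dotp0r addr0 bi.
by rewrite dotpC dotp_delta => ->.
Qed.

Lemma card_basis (B : {set I}) : indep cayley B -> full cayley B ->
  #|B| = (n + n)%N.
Proof.
move=> iB fB; pose A : 'M[R]_(#|B|, n + n) := \matrix_(k < #|B|) cayley (enum_val k).
have Af : row_free A.
  apply: inj_row_free => v vA.
  pose z b := \sum_(k < #|B| | enum_val k == b) v ord0 k.
  have z0 : forall b, z b = 0.
    apply: iB => [b bB|].
      by apply: big1 => k /eqP kb; case/negP: bB; rewrite -kb enum_valP.
    transitivity (v *m A) => //; rewrite mulmx_sum_row /comb.
    under eq_bigr do rewrite /z scaler_suml.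
    rewrite (exchange_big_dep xpredT)//=; apply: eq_bigr => k _.
    by rewrite (big_pred1 (enum_val k)) ?rowK// => b; rewrite eq_sym.
  apply/rowP => k; rewrite mxE -[RHS](z0 (enum_val k)) /z.
  rewrite (big_pred1 k)// => l; exact: (inj_eq enum_val_inj).
have Aff : row_free A^T.
  apply: inj_row_free => v vA.
  apply: fB => b bB; have /rowP/(_ (enum_rank_in bB b)) := vA.
  rewrite !mxE => <-; apply: eq_bigr => j _.
  by rewrite !mxE enum_rankK_in// mulrC.
by move: Af Aff; rewrite /row_free mxrank_tr => /eqP -> /eqP.
Qed.

(** Otherwise (e_i, 0) would be orthogonal to all of [B]. *)
Lemma basis_color (B : {set I}) i : full cayley B -> exists2 b, b \in B & ka b = i.
Proof.
move=> fB; have [h|] := pselect (exists2 b, b \in B & ka b = i); first by [].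
move=> nB; have : row_mx (delta_mx 0 i) 0 = 0 :> 'rV[R]_(n + n).
  apply: fB => b bB; rewrite dotp_row_mx dotp0r addr0 dotp_delta mxE eqxx.
  by case: eqP => // ib; case: nB; exists b.
move/rowP/(_ (lshift n i)); rewrite row_mxEl !mxE !eqxx => /eqP.
by rewrite oner_eq0.
Qed.

(** A product of open simplices of sizes [lam i]; [h k] names the simplex to which coordinate [k]
    belongs. *)
Definition open_simplices (h : 'I_n -> 'I_n) (lam : 'I_n -> R) : set 'rV[R]_n :=
  [set v | (forall k, 0 < v ord0 k) /\
           (forall i, \sum_(k | h k == i) v ord0 k < lam i)].

Lemma row_mset_open_simplices h lam : row_mset (open_simplices h lam).
Proof.
rewrite (_ : open_simplices h lam = [set v | forall k, 0 < v ord0 k] `&`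
   [set v | forall i, 0 < lam i - \sum_(k | h k == i) v ord0 k]); last first.
  by apply/seteqP; split => v [h1 h2]; split => // i; have := h2 i; rewrite subr_gt0.
apply: row_msetI; apply: row_mset_forall => i; apply: row_mset_affine_gt.
  exact: is_affine_coord.
apply: is_affineD; first exact: is_affine_cst.
under eq_fun do rewrite -mulN1r; apply: is_affineZ.
under eq_fun do rewrite big_mkcond; apply: is_affine_sum => k.
by case: (h k == i); [exact: is_affine_coord|exact: is_affine_cst].
Qed.

(* Choosing one basis element of each colour eliminates the colour equations;
   the remaining [n] weights are affine coordinates on the cell. *)
Lemma vol_open_cell (B : {set I}) : indep cayley B -> full cayley B ->
  exists (C : R) (h : {ffun 'I_n -> 'I_n}), forall lam, (forall i, 0 < lam i) ->
    vol (open_cell B lam) = (C * \prod_k lam (h k))%:E.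
Proof.
move=> iB fB.
have [r rP] : {r : 'I_n -> I & forall i, r i \in B /\ ka (r i) = i}.
  apply: (@boolp.choice _ _ (fun i b => b \in B /\ ka b = i)) => i.
  by have [b bB bi] := basis_color i fB; exists b.
have rB i : r i \in B by case: (rP i).
have kr i : ka (r i) = i by case: (rP i).
have r_inj : injective r by move=> i j /(congr1 ka); rewrite !kr.
pose B' := B :\: [set r i | i : 'I_n].
have cB' : #|B'| = n.
  rewrite cardsD (finset.setIidPr _) ?card_imset// ?(card_basis iB fB) ?card_ord ?addnK//.
  by apply/fintype.subsetP => _ /imsetP[i _ ->].
pose g (k : 'I_n) : I := enum_val (cast_ord (esym cB') k).
have g_inj : injective g by move=> k l /enum_val_inj/cast_ord_inj.
have gB' k : g k \in B' by exact: enum_valP.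
have gB k : g k \in B by have := gB' k; rewrite inE => /andP[].
have gr k i : g k != r i.
  apply/eqP => e; have := gB' k; rewrite inE e => /andP[/negP[]].
  by rewrite imset_f.
have B'g b : b \in B' -> exists k, b = g k.
  move=> bB'; exists (cast_ord cB' (enum_rank_in bB' b)).
  by rewrite /g cast_ordK enum_rankK_in.
pose h := [ffun k => ka (g k)].
pose M : 'M[R]_n := \matrix_k (p (g k) - p (r (h k))).
(* The free weights sit on [g k], and [r i] takes what is left of the total [mu i]. The totals stay
   a parameter: zero totals yield invertibility of [M], and [lam] yields the cell. *)
pose z (mu : 'I_n -> R) (v : 'rV[R]_n) b : R :=
  if b == r (ka b) then mu (ka b) - \sum_(k | h k == ka b) v ord0 k
  else \sum_(k | g k == b) v ord0 k.
have zr mu v i : z mu v (r i) = mu i - \sum_(k | h k == i) v ord0 k.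
  by rewrite /z kr eqxx.
have zg mu v k : z mu v (g k) = v ord0 k.
  by rewrite /z (negPf (gr _ _)) (big_pred1 k)// => l; exact: (inj_eq g_inj).
have zB mu v b : b \notin B -> z mu v b = 0.
  move=> bB; rewrite /z ifN; last by apply: contra bB => /eqP ->.
  by apply: big1 => k /eqP kb; rewrite -kb gB in bB.
have sumB (V : lmodType R) (F : I -> V) : (forall b, b \notin B -> F b = 0) ->
    \sum_b F b = \sum_i F (r i) + \sum_k F (g k).
  move=> FB; rewrite (bigID (fun b => b \in B)) /= [X in _ + X]big1 ?addr0//.
  rewrite (bigID (fun b => b \in [set r i | i : 'I_n])) /=; congr (_ + _).
    rewrite (eq_bigl (fun b => b \in [set r i | i : 'I_n])).
      by rewrite big_imset//= => i j _ _; exact: r_inj.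
    by move=> b; rewrite andb_idl// => /imsetP[i _ ->].
  rewrite (eq_bigl (fun b => b \in [set g k | k : 'I_n])).
    by rewrite big_imset//= => i j _ _; exact: g_inj.
  move=> b; apply/idP/imsetP => [/andP[h1 h2]|[k _ ->]].
    by have [|k ->] := B'g b; [rewrite inE h1 h2|exists k].
  by have := gB' k; rewrite inE andbC.
pose s (mu : 'I_n -> R) := \sum_i mu i *: p (r i).
have combz mu v : comb cayley (z mu v) = row_mx (row_fun mu) (v *m M + s mu).
  rewrite comb_cayley; congr row_mx.
    apply/rowP => i; rewrite !mxE big_mkcond /= (sumB R^o); last first.
      by move=> b bB; rewrite zB// if_same.
    rewrite (bigD1 i)//= kr eqxx zr [X in _ + X + _]big1 ?addr0; last first.
      by move=> j ji /=; rewrite kr (negPf ji).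
    rewrite -big_mkcond/= [X in _ + X = _](eq_big (fun k => h k == i) (fun k => v ord0 k)).
    - by rewrite subrK.
    - by move=> k; rewrite ffunE.
    - by move=> k _; rewrite zg.
  rewrite sumB; last by move=> b bB; rewrite zB// scale0r.
  rewrite mulmx_sum_row (eq_bigr (fun i => mu i *: p (r i) -
     \sum_(k | h k == i) v ord0 k *: p (r i))); last first.
    by move=> i _; rewrite zr scalerBl scaler_suml.
  rewrite sumrB -/(s mu) [RHS]addrC -addrA; congr (_ + _).
  rewrite (exchange_big_dep xpredT)//= addrC.
  rewrite (eq_bigr (fun k => v ord0 k *: p (g k))) -?sumrB; last first.
    by move=> k _; rewrite zg.
  apply: eq_bigr => k _; rewrite rowK scalerBr; congr (_ - _).
  by rewrite (big_pred1 (h k))// => i; rewrite eq_sym.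
have Mu : M \in unitmx.
  rewrite -row_free_unit; apply: inj_row_free => v vM.
  have zz : forall b, z (fun=> 0) v b = 0.
    apply: iB; first exact: zB.
    rewrite combz vM add0r /s big1; last by move=> i _; rewrite scale0r.
    rewrite (_ : row_fun _ = 0) ?row_mx0//; apply/rowP => i; by rewrite !mxE.
  by apply/rowP => k; rewrite mxE -[RHS](zz (g k)) zg.
have cellE lam : [set v | open_cell B lam (v *m M + s lam)] = open_simplices h lam.
  apply/seteqP; split => v /=.
    move=> [w [w0 wB]]; rewrite -combz => /(indep_inj iB wB (zB _ _)) wz.
    split => [k|i]; first by have := w0 _ (gB k); rewrite wz zg.
    by have := w0 _ (rB i); rewrite wz zr subr_gt0.
  move=> [h1 h2]; exists (z lam v); split => //; last exact: zB.
  move=> b bB; have [/imsetP[i _ ->]|nb] := boolP (b \in [set r i | i : 'I_n]).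
    by rewrite zr subr_gt0.
  by have [|k ->] := B'g b; [rewrite inE nb|rewrite zg].
have [c c0 cP] := vol_affine Mu.
have D1 : (vol (open_simplices h (fun=> 1%R)) <= 1)%E.
  apply: vol_unit_box; first exact: row_mset_open_simplices.
  move=> v [h1 h2] k; rewrite ltW//=; apply: ltW; apply: le_lt_trans (h2 (h k)).
  by rewrite (bigD1 k)//= lerDl; apply: sumr_ge0 => l _; exact: ltW.
have Df : vol (open_simplices h (fun=> 1)) \is a fin_num.
  by rewrite ge0_fin_numE ?vol_ge0// (le_lt_trans D1)// ltry.
(* Neither factor involves [lam]: the monomial comes from rescaling coordinate [k] by [lam (h k)],
   which turns the cell into unit simplices. *)
exists (c * fine (vol (open_simplices h (fun=> 1)))), h => lam lam0.
rewrite (cP _ (s lam)); last exact: row_mset_open_cell.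
rewrite cellE (vol_diag (d := row_fun (fun k => lam (h k)))); first last.
- exact: row_mset_open_simplices.
- by move=> k; rewrite mxE.
rewrite (_ : [set x | _] = open_simplices h (fun=> 1)); last first.
  have dE (v : 'rV[R]_n) k :
      (v *m diag_mx (row_fun (fun k => lam (h k)))) ord0 k = v ord0 k * lam (h k).
    by rewrite mul_mx_diag !mxE.
  have sE (v : 'rV[R]_n) i :
      \sum_(k | h k == i) (v *m diag_mx (row_fun (fun k => lam (h k)))) ord0 k =
      (\sum_(k | h k == i) v ord0 k) * lam i.
    by rewrite mulr_suml; apply: eq_bigr => k /eqP <-; rewrite dE.
  apply/seteqP; split => v [h1 h2]; split => [k|i].
  - by have := h1 k; rewrite dE pmulr_lgt0.
  - by have := h2 i; rewrite sE gtr_pMl.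
  - by rewrite dE mulr_gt0.
  - by rewrite sE gtr_pMl.
rewrite -[X in (_ * (_ * X))%E]fineK// -!EFinM; congr EFin.
rewrite (eq_bigr (fun k => lam (h k))); last by move=> k _; rewrite mxE.
by rewrite -[RHS]mulrA; congr (c * _); rewrite mulrC.
Qed.

Theorem vol_mink_sum : exists A : {ffun 'I_n -> 'I_n} -> R,
  forall lam, (forall i, 0 < lam i) ->
    vol (mink_sum lam) =
    (\sum_(h : {ffun 'I_n -> 'I_n}) A h * \prod_k lam (h k))%:E.
Proof.
(* The costs are fixed before [lam], hence so are the contributing bases and the coefficients. *)
have [c c0 gen] := generic_exists cayley.
pose P (B : {set I}) := `[< [/\ indep cayley B, full cayley B &
  dual_feasible cayley c B] >].
have [Ch ChP] : {Ch : {set I} -> R * {ffun 'I_n -> 'I_n} & forall B, P B ->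
    forall lam, (forall i, 0 < lam i) ->
    vol (open_cell B lam) = ((Ch B).1 * \prod_k lam ((Ch B).2 k))%:E}.
  apply: (@boolp.choice _ _ (fun (B : {set I}) (Ch : R * {ffun 'I_n -> 'I_n}) => P B ->
    forall lam, (forall i, 0 < lam i) ->
    vol (open_cell B lam) = (Ch.1 * \prod_k lam (Ch.2 k))%:E)) => B.
  have [/asboolP[iB fB _]|nP] := boolP (P B).
    by have [C [h H]] := vol_open_cell iB fB; exists (C, h).
  by exists (0, [ffun i => i]).
exists (fun h => \sum_(B | P B && ((Ch B).2 == h)) (Ch B).1) => lam lam0.
have -> : \sum_(h : {ffun 'I_n -> 'I_n})
    (\sum_(B | P B && ((Ch B).2 == h)) (Ch B).1) * \prod_k lam (h k) =
    \sum_(B | P B) (Ch B).1 * \prod_k lam ((Ch B).2 k).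
  rewrite [RHS](partition_big (fun B => (Ch B).2) xpredT)//=.
  apply: eq_bigr => h _; rewrite mulr_suml; apply: eq_bigr => B /andP[_ /eqP ->].
  by [].
rewrite -sumEFin (eq_bigr (fun B => vol (open_cell B lam))); last first.
  by move=> B PB; rewrite ChP.
(* Lower bound by packing the disjoint open cells; upper bound by covering with [Cl], whose
   additional closed cells are null. *)
apply/eqP; rewrite eq_le; apply/andP; split; last first.
  apply: vol_pack.
  - exact: row_mset_mink_sum.
  - by move=> B /asboolP[iB _ _]; exact: row_mset_open_cell.
  - move=> B x _ [w [w0 wB wx]]; exists w => // b.
    by have [/w0/ltW//|/wB ->] := boolP (b \in B).
  move=> B B' x /asboolP[_ _ dB] /asboolP[_ _ dB'] [w [w0 wB wx]] [w' [w'0 wB' wx']].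
  have sw (D : {set I}) (u : I -> R) : (forall b, b \in D -> 0 < u b) ->
      (forall b, b \notin D -> u b = 0) -> supp u = D /\ forall b, 0 <= u b.
    move=> u0 uD; split=> [|b]; last first.
      by have [/u0/ltW//|/uD ->] := boolP (b \in D).
    apply/setP => b; rewrite inE; have [/u0/lt0r_neq0//|/uD ->] := boolP (b \in D).
    by rewrite eqxx.
  have [e1 g1] := sw _ _ w0 wB; have [e2 g2] := sw _ _ w'0 wB'.
  rewrite -e1 -e2; apply: (@dual_feasible_uniq _ _ _ cayley c) => //.
  - by rewrite wx wx'.
  - by rewrite e1.
  - by rewrite e2.
pose Cl (J : {set I}) := if P J then open_cell J lam
  else if `[< indep cayley J /\ ~ full cayley J >] then closed_cell J lam else set0.
have mCl J : row_mset (Cl J).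
  rewrite /Cl; case: ifP => [/asboolP[iB _ _]|_]; first exact: row_mset_open_cell.
  case: ifP => [/asboolP[iB _]|_]; first exact: row_mset_closed_cell.
  exact: row_mset0.
apply: le_trans (vol_cover (row_mset_mink_sum lam) mCl _) _.
  move=> x [w w0 wx]; have [w' [h1 h2 h3 h4]] := optimum_generic c0 gen w0.
  have ws b : b \notin supp w' -> w' b = 0 by rewrite inE negbK => /eqP.
  exists (supp w'); rewrite /Cl; case: ifPn => [_|nP].
    exists w'; split => //; last by rewrite h2.
    by move=> b; rewrite inE => wb; rewrite lt_def wb h1.
  have nf : ~ full cayley (supp w').
    by move=> f; move/negP: nP; apply; apply/asboolP; split => //; exact: h4.
  case: ifPn => [_|/asboolP[]]; last by split.
  by exists w'; split => //; rewrite h2.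
rewrite [leLHS](bigID P) /= [X in (_ + X)%E]big1 ?adde0.
  by apply: lee_sum => J PJ; rewrite /Cl PJ.
move=> J /negPf nP; rewrite /Cl nP; case: ifP => [/asboolP[iJ nf]|_].
  exact: vol_closed_cell_not_full.
exact: vol_set0.
Qed.

End Cells.

(** * Mixed volumes *)

Section MixedVolume.
Variables (R : realType) (n : nat).
Implicit Types (lam : 'I_n -> R) (A : {ffun 'I_n -> 'I_n} -> R).

(** * Coefficients of polynomials on the positive orthant *)

Lemma radix_inj k (D : nat) (e e' : 'I_k -> nat) :
  (forall i, e i < D)%N -> (forall i, e' i < D)%N ->
  (\sum_i e i * D ^ i = \sum_i e' i * D ^ i)%N -> e =1 e'.
Proof.
elim: k e e' => [e e' _ _ _ []//|k IH] e e' eD e'D.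
have step (f : 'I_k.+1 -> nat) : (\sum_i f i * D ^ i =
    (\sum_(i < k) f (lift ord0 i) * D ^ i) * D + f ord0)%N.
  rewrite big_ord_recl expn0 muln1 addnC big_distrl /=; congr (_ + _)%N.
  by apply: eq_bigr => i _; rewrite /bump /= add1n expnSr mulnA.
rewrite !step => E.
have D0 : (0 < D)%N by apply: leq_ltn_trans (eD ord0).
have e0 : e ord0 = e' ord0.
  by have := congr1 (modn^~ D) E; rewrite /= !modnMDl !modn_small.
have /eqP := E; rewrite e0 eqn_add2r eqn_pmul2r// => /eqP E'.
have {}IH := IH _ _ (fun i => eD (lift ord0 i)) (fun i => e'D (lift ord0 i)) E'.
by move=> i; case: (unliftP ord0 i) => [j ->|->].
Qed.

(* Kronecker substitution: lam_i = x ^ (D ^ i) turns distinct exponent vectors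
   with entries below D into distinct powers of x. *)
Lemma monomials_free (E : finType) (A : E -> R) (e : E -> 'I_n -> nat) :
  (forall lam, (forall i, 0 < lam i) ->
     \sum_t A t * \prod_i lam i ^+ e t i = 0) ->
  forall e0 : 'I_n -> nat, \sum_(t | [forall i, e t i == e0 i]) A t = 0.
Proof.
move=> H e0.
(* [D] exceeds the exponents of all the monomials and of the target [e0], so base-[D] digits recover
   both. *)
pose D := (\max_t \max_i e t i + \max_i e0 i).+1.
have eD t i : (e t i < D)%N.
  rewrite ltnS (leq_trans _ (leq_addr _ _))//.
  by rewrite (leq_trans _ (leq_bigmax t))// (leq_trans _ (leq_bigmax i)).
have e0D i : (e0 i < D)%N.
  by rewrite ltnS (leq_trans _ (leq_addl _ _))// (leq_trans _ (leq_bigmax i)).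
pose K (f : 'I_n -> nat) := (\sum_i f i * D ^ i)%N.
pose p : {poly R} := \sum_t A t *: 'X^(K (e t)).
have p0 : p = 0.
  apply/eqP; apply: contraT => /poly_nonroot_nat[k] /negP; case; apply/eqP.
  rewrite /p horner_sum -[RHS](H (fun i => k.+1%:R ^+ (D ^ i))); last first.
    by move=> i; rewrite exprn_gt0.
  apply: eq_bigr => t _; rewrite hornerZ hornerXn -prodrXr; congr (_ * _).
  by apply: eq_bigr => i _; rewrite -exprM mulnC.
have /polyP/(_ (K e0)) := p0; rewrite coef0 coef_sum => pK.
rewrite -[RHS]pK [LHS]big_mkcond /=; apply: eq_bigr => t _; rewrite coefZ coefXn.
case: ifPn => [/forallP h|h].
  rewrite (_ : K e0 = K (e t)) ?eqxx ?mulr1//; apply: eq_bigr => i _.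
  by rewrite (eqP (h i)).
case: eqP => [E0|_]; last by rewrite mulr0.
case/negP: h; apply/forallP => i; apply/eqP/esym.
exact: radix_inj (fun i => e0D i) (fun i => eD t i) E0 i.
Qed.

Definition hpoly A lam := \sum_(h : {ffun 'I_n -> 'I_n}) A h * \prod_k lam (h k).

(** The words [h] whose monomial is lam_1 ... lam_n are the permutations. *)
Definition hcoef A := \sum_(h : {ffun 'I_n -> 'I_n} | injectiveb h) A h.

Definition fiber_card (h : {ffun 'I_n -> 'I_n}) i := #|[pred k | h k == i]|.

Lemma prod_fiber lam (h : {ffun 'I_n -> 'I_n}) :
  \prod_k lam (h k) = \prod_i lam i ^+ fiber_card h i.
Proof.
rewrite (partition_big h xpredT)//=; apply: eq_bigr => i _.
rewrite -prodr_const; apply: eq_big => k; first by rewrite inE.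
by move=> /eqP ->.
Qed.

Lemma fiber_card1 (h : {ffun 'I_n -> 'I_n}) :
  [forall i, fiber_card h i == 1%N] = injectiveb h.
Proof.
apply/forallP/injectiveP => [h1 k l hkl|hi i].
  have /eqP/eq_leq/card_le1P := h1 (h k).
  move=> /(_ k); rewrite inE eqxx => /(_ isT l).
  by rewrite !inE hkl eqxx => /esym/eqP.
have [g hg gh] := injF_bij hi.
rewrite /fiber_card -(card1 (g i)); apply/eqP/eq_card => k.
by rewrite !inE; apply/eqP/eqP => [<-|->]; rewrite ?hg ?gh.
Qed.

(** The value chosen by [xget] may come from any polynomial representation, so uniqueness is needed
    as well: the difference of two representations vanishes on the positive orthant. *)
Lemma mixed_volume_hpoly (Q : 'I_n -> set 'rV[R]_n) A :
  (forall lam, (forall i, 0 < lam i) -> vol (Defs.msum lam Q) = (hpoly A lam)%:E) ->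
  mixed_volume Q = hcoef A.
Proof.
move=> H.
have isM : is_mixed_volume Q (hcoef A).
  have cn h i : (fiber_card h i < n.+2)%N.
    by rewrite ltnS (leq_trans (max_card _))// card_ord.
  pose ef h : {ffun 'I_n -> 'I_n.+2} := [ffun i => inord (fiber_card h i)].
  (* Every exponent is the size of a fibre of [h], at most n, so d = n suffices. *)
  exists n, (fun e => \sum_(h | ef h == e) A h); split=> [lam lam0|].
    rewrite H//; congr EFin; rewrite /hpoly (partition_big ef xpredT)//=.
    apply: eq_bigr => e _; rewrite mulr_suml; apply: eq_bigr => h /eqP <-.
    rewrite prod_fiber; congr (_ * _); apply: eq_bigr => i _.
    by rewrite ffunE inordK.
  apply: eq_bigl => h; rewrite -fiber_card1; apply/forallP/eqP => [h1|/ffunP h1 i].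
    by apply/ffunP => i; rewrite !ffunE (eqP (h1 i)).
  by have /(congr1 val) := h1 i; rewrite !ffunE /= !inordK// => ->.
have [d [a [aE]]] : is_mixed_volume Q (mixed_volume Q).
  by apply: (@xgetPex _ 0 [set c | is_mixed_volume Q c]); exists (hcoef A).
move=> ->.
(* One family over a sum type holds both polynomials, the second with opposite signs. *)
pose E := ({ffun 'I_n -> 'I_n} + {ffun 'I_n -> 'I_d.+2})%type.
have := @monomials_free E
  (fun t => match t with inl h => A h | inr e => - a e end)
  (fun t => match t with inl h => fiber_card h | inr e => fun i => e i end) _
  (fun=> 1%N).
rewrite big_mkcond big_sumType /= -!big_mkcond /=.
rewrite (eq_bigl _ _ fiber_card1) -/(hcoef A) sumrN => h.
apply/esym/eqP; rewrite -subr_eq0; apply/eqP; rewrite -[RHS]h.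
  congr (_ - _); rewrite (big_pred1 [ffun _ => inord 1])// => e.
  apply/forallP/eqP => [e1|-> i]; last by rewrite ffunE inordK.
  by apply/ffunP => i; rewrite ffunE; apply/val_inj; rewrite /= inordK// (eqP (e1 i)).
move=> lam lam0; rewrite big_sumType /=.
under [X in _ + X]eq_bigr do rewrite mulNr.
rewrite sumrN; have := H lam lam0; rewrite aE// => -[->].
by apply/eqP; rewrite subr_eq0; apply/eqP; apply: eq_bigr => h' _; rewrite prod_fiber.
Qed.

Definition incr lam (j : 'I_n) (s : R) k := if k == j then lam k + s else lam k.

(** The difference polynomial is constant in [lam j], hence equals its value at lam j = 1, where no
    monomial contains lam j; so its coefficient of lam_1 ... lam_n is 0. *)
Lemma hcoef_indep A A' j :
  (forall lam s, (forall i, 0 < lam i) -> 0 < s ->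
    hpoly A' (incr lam j s) - hpoly A (incr lam j s) = hpoly A' lam - hpoly A lam) ->
  hcoef A' = hcoef A.
Proof.
move=> H; pose d h := A' h - A h.
have dE lam : hpoly d lam = hpoly A' lam - hpoly A lam.
  by rewrite /hpoly -sumrB; apply: eq_bigr => h _; rewrite mulrBl.
pose one lam k := if k == j then 1 else lam k.
have d1 lam : (forall i, 0 < lam i) -> hpoly d lam = hpoly d (one lam).
  move=> lam0; have one0 i : 0 < one lam i by rewrite /one; case: ifP.
  have [lt|lt|e] := ltgtP (lam j) 1.
  - rewrite (_ : one lam = incr lam j (1 - lam j)).
      by rewrite [RHS]dE H ?subr_gt0// dE.
    by apply/funext => k; rewrite /one /incr; case: eqP => // ->; rewrite addrC subrK.
  - rewrite (_ : hpoly d lam = hpoly d (incr (one lam) j (lam j - 1))).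
      by rewrite dE H ?subr_gt0// dE.
    congr hpoly; apply/funext => k; rewrite /one /incr; case: eqP => // ->.
    by rewrite addrC subrK.
  - by congr hpoly; apply/funext => k; rewrite /one; case: eqP => // ->.
pose F := {ffun 'I_n -> 'I_n}; pose E := (F + F)%type.
have := @monomials_free E
  (fun t => match t with inl h => d h | inr h => - d h end)
  (fun t => match t with inl h => fiber_card h
     | inr h => fun i => if i == j then 0%N else fiber_card h i end) _
  (fun=> 1%N).
rewrite big_mkcond big_sumType /= -!big_mkcond /=.
rewrite (eq_bigl _ _ fiber_card1) [X in _ + X]big1 ?addr0; last first.
  by move=> h /forallP/(_ j); rewrite eqxx.
rewrite sumrB => h; apply/eqP; rewrite -subr_eq0; apply/eqP; apply: h.
move=> lam lam0; rewrite big_sumType /=.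
under [X in _ + X]eq_bigr do rewrite mulNr.
rewrite sumrN; apply/eqP; rewrite subr_eq0; apply/eqP.
transitivity (hpoly d lam); first by apply: eq_bigr => h' _; rewrite prod_fiber.
rewrite d1//; apply: eq_bigr => h' _; rewrite prod_fiber; congr (_ * _).
by apply: eq_bigr => i _; rewrite /one; case: eqP => // _; rewrite expr1n expr0.
Qed.

Lemma hpoly_cst (c : R) lam : hpoly (fun=> c) lam = c * (\sum_i lam i) ^+ n.
Proof.
rewrite /hpoly -mulr_sumr; congr (_ * _).
rewrite -(bigA_distr_bigA (fun=> lam)) /=.
by rewrite prodr_const card_ord.
Qed.

Lemma hcoef_cst (c : R) : hcoef (fun=> c) = n`!%:R * c.
Proof.
rewrite /hcoef sumr_const mulr_natl; congr (_ *+ _).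
rewrite -[RHS]ffactnn -[in RHS](card_ord n) -card_inj_ffuns.
by apply: eq_card => h; rewrite !inE.
Qed.

(** * Hulls of finite lists and Farkas certificates *)

Definition hull (s : seq 'rV[R]_n) : set 'rV[R]_n := conv_hull [set x | x \in s].

Lemma hullP (s : seq 'rV[R]_n) x : hull s x <->
  exists w : 'I_(size s) -> R, [/\ forall j, 0 <= w j, \sum_j w j = 1 &
    x = \sum_j w j *: s`_j].
Proof.
split=> [[m [w [p [w0 w1 ps ->]]]]|[w [w0 w1 ->]]]; last first.
  by exists (size s), w, (fun j => s`_j); split=> // j; exact: mem_nth.
have ind k : (index (p k) s < size s)%N by rewrite index_mem; exact: ps.
pose f k := Ordinal (ind k).
exists (fun j => \sum_(k | f k == j) w k); split=> [j||].
- exact: sumr_ge0.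
- by rewrite -w1 [RHS](partition_big f xpredT).
rewrite (partition_big f xpredT)//=; apply: eq_bigr => j _.
rewrite scaler_suml; apply: eq_bigr => k /eqP <-.
by rewrite /= nth_index//; exact: ps.
Qed.

Lemma hull_mem (s : seq 'rV[R]_n) x : x \in s -> hull s x.
Proof.
move=> xs; exists 1%N, (fun=> 1), (fun=> x); split=> //.
  by rewrite big_ord1.
by rewrite big_ord1 scale1r.
Qed.

Lemma hull_sub (s t : seq 'rV[R]_n) : {subset s <= t} -> hull s `<=` hull t.
Proof. by move=> st x [m [w [p [w0 w1 ps ->]]]]; exists m, w, p; split=> // i; exact/st/ps. Qed.

Lemma hull_ge (s : seq 'rV[R]_n) x al (mu : R) : hull s x ->
  (forall p, p \in s -> mu <= dotp p al) -> mu <= dotp x al.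
Proof.
move=> [m [w [p [w0 w1 ps ->]]]] h.
rewrite dotp_suml -[mu]mul1r -w1 mulr_suml; apply: ler_sum => i _.
by rewrite dotpZl ler_wpM2l// h//; exact: ps.
Qed.

Definition hsum (T : 'I_n -> seq 'rV[R]_n) lam := Defs.msum lam (fun i => hull (T i)).

(** The Cayley index is a body together with a position in its list. Convex weights are multiplied
    by [lam i] in one direction and recovered by division in the other. *)
Lemma hsum_mink_sum (T : 'I_n -> seq 'rV[R]_n) lam : (forall i, 0 < lam i) ->
  hsum T lam = @mink_sum R n {i : 'I_n & 'I_(size (T i))} tag
     (fun b => (T (tag b))`_(tagged b)) lam.
Proof.
move=> lam0; pose I := {i : 'I_n & 'I_(size (T i))}.
pose tg i (j : 'I_(size (T i))) : I := Tagged (fun i => 'I_(size (T i))) j.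
have sumI (V : nmodType) (F : I -> V) : \sum_b F b = \sum_i \sum_j F (tg i j).
  by rewrite (sig_big_dep _ _ (fun i j => F (tg i j))) /=; apply: eq_bigr => -[].
have sumIi (V : nmodType) (F : I -> V) i :
    \sum_(b | tag b == i) F b = \sum_j F (tg i j).
  transitivity (\sum_(i' | i' == i) \sum_j F (tg i' j)); last first.
    by rewrite big_pred1_eq.
  rewrite (sig_big_dep _ _ (fun i j => F (tg i j))) /=.
  by apply: eq_big => -[a b] //=; rewrite andbT.
apply/seteqP; split=> x.
  move=> [q [qT ->]].
  have ex i := (hullP (T i) (q i)).1 (qT i).
  pose w i := projT1 (cid (ex i)).
  have wP i : [/\ forall j, 0 <= w i j, \sum_j w i j = 1 &
      q i = \sum_j w i j *: (T i)`_j] := projT2 (cid (ex i)).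
  exists (fun b => lam (tag b) * w (tag b) (tagged b)).
    move=> b; apply: mulr_ge0; first exact: ltW.
    by have [h _ _] := wP (tag b); exact: h.
  rewrite comb_cayley; congr row_mx.
    apply/rowP => i; rewrite !mxE sumIi /= -mulr_sumr.
    by have [_ -> _] := wP i; rewrite mulr1.
  rewrite sumI; apply: eq_bigr => i _ /=; have [_ _ ->] := wP i.
  by rewrite scaler_sumr; apply: eq_bigr => j _; rewrite scalerA.
move=> [w w0]; rewrite comb_cayley => /eq_row_mx[wl wx].
have wi i : \sum_(j < size (T i)) w (tg i j) = lam i.
  by have /rowP/(_ i) := wl; rewrite !mxE sumIi.
exists (fun i => \sum_(j < size (T i)) (w (tg i j) / lam i) *: (T i)`_j); split.
  move=> i; apply/hullP; exists (fun j => w (tg i j) / lam i); split=> // [j|].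
    by rewrite divr_ge0// ltW.
  by rewrite -mulr_suml wi divff// gt_eqF.
rewrite -wx sumI; apply: eq_bigr => i _ /=; rewrite scaler_sumr.
by apply: eq_bigr => j _; rewrite scalerA mulrC divfK// gt_eqF.
Qed.

Lemma row_mset_hsum (T : 'I_n -> seq 'rV[R]_n) lam : (forall i, 0 < lam i) ->
  row_mset (hsum T lam).
Proof. by move=> lam0; rewrite hsum_mink_sum//; exact: row_mset_mink_sum. Qed.

Lemma vol_hsum (T : 'I_n -> seq 'rV[R]_n) : exists A, forall lam,
  (forall i, 0 < lam i) -> vol (hsum T lam) = (hpoly A lam)%:E.
Proof.
have [A AP] := @vol_mink_sum R n {i : 'I_n & 'I_(size (T i))} tag
     (fun b => (T (tag b))`_(tagged b)).
by exists A => lam lam0; rewrite hsum_mink_sum// AP.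
Qed.

Definition lower_bounds (T : 'I_n -> seq 'rV[R]_n) (al : 'rV[R]_n) (mu : 'I_n -> R) :=
  forall i p, p \in T i -> mu i <= dotp p al.

(** Farkas's lemma for the Cayley cone, whose dual consists of the pairs (-mu, al). Arbitrary lower
    bounds stand in place of minima so that certificates can be added. *)
Lemma hsum_dual (T : 'I_n -> seq 'rV[R]_n) lam x : (forall i, 0 < lam i) ->
  hsum T lam x <-> forall al mu, lower_bounds T al mu ->
    \sum_i lam i * mu i <= dotp x al.
Proof.
move=> lam0; split=> [[q [qT ->]] al mu lb|H].
  rewrite dotp_suml; apply: ler_sum => i _; rewrite dotpZl.
  apply: ler_wpM2l; first exact: ltW.
  by apply: hull_ge (qT i) _ => p; exact: lb.
rewrite hsum_mink_sum//.
pose I := {i : 'I_n & 'I_(size (T i))}.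
have [|w w0 wE] := @farkas R I _ (@cayley R n I tag
   (fun b => (T (tag b))`_(tagged b))) (row_mx (row_fun lam) x).
  move=> al al0; rewrite -[al]hsubmxK dotp_row_mx.
  have := H (rsubmx al) (fun i => - lsubmx al ord0 i).
  rewrite (_ : \sum_i _ = - dotp (row_fun lam) (lsubmx al)); last first.
    by rewrite /dotp -sumrN; apply: eq_bigr => i _; rewrite mulrN [in RHS]mxE.
  move=> Hm; rewrite -lerBlDl sub0r; apply: Hm => i p pT.
  pose k : 'I_(size (T i)) := Ordinal (etrans (index_mem p (T i)) pT).
  have := al0 (Tagged (fun i => 'I_(size (T i))) k).
  rewrite -{1}[al]hsubmxK dotp_row_mx [dotp (delta_mx _ _) _]dotpC dotp_delta.
  by rewrite /= nth_index// -lerBlDl sub0r.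
by exists w.
Qed.

Lemma hsum_incl (T T' : 'I_n -> seq 'rV[R]_n) lam :
  (forall i, {subset T i <= T' i}) -> hsum T lam `<=` hsum T' lam.
Proof.
move=> TT' x [q [qT ->]]; exists q; split => // i; exact: hull_sub (qT i).
Qed.

Lemma sum_incr lam j s mu :
  \sum_i incr lam j s i * mu i = \sum_i lam i * mu i + s * mu j.
Proof.
rewrite (bigD1 j)//= [in RHS](bigD1 j)//= /incr eqxx mulrDl.
rewrite (eq_bigr (fun i => lam i * mu i)); first by rewrite addrAC.
by move=> i /negPf ->.
Qed.

(** * Adding an exposed point to one body *)

Definition min_at (V : seq 'rV[R]_n) (v al : 'rV[R]_n) :=
  forall p, p \in V -> dotp v al <= dotp p al.

Definition exposed (V : seq 'rV[R]_n) (v : 'rV[R]_n) :=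
  exists be, forall p, p \in V -> p != v -> dotp v be < dotp p be.

(** The face hypothesis in terms of normals: moving out of the normal cone of [v], one meets a
    normal, still in the cone, whose face contains both [v] and a point of [s]. *)
Definition touches (V s : seq 'rV[R]_n) := forall v al1 al2, v \in V ->
  min_at V v al1 -> ~ min_at V v al2 -> exists t, [/\ 0 <= t,
    min_at V v (al1 + t *: al2) &
    exists2 q, q \in s & dotp q (al1 + t *: al2) = dotp v (al1 + t *: al2)].

(** Otherwise move from the exposing normal of [v] towards [al]: at the wall some [q] in [s] ties
    with [v], yet [q] lies strictly above [v] for both normals. *)
Lemma touches_exposed (V s : seq 'rV[R]_n) v al : touches V s ->
  {subset s <= V} -> v \in V -> exposed V v ->
  (forall q, q \in s -> dotp v al < dotp q al) -> min_at V v al.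
Proof.
move=> tVs sV vV [be bev] lt; apply: contrapT => nmin.
have bemin : min_at V v be.
  by move=> p pV; have [->//|pv] := eqVneq p v; exact/ltW/bev.
have [t [t0 _ [q qs E]]] := tVs v be al vV bemin nmin.
have := lt q qs; apply/negP; rewrite -leNgt.
have [->//|qv] := eqVneq q v.
have beq := bev q (sV q qs) qv.
move: E; rewrite !dotpDr !dotpZr => E.
have tp : 0 < t.
  rewrite lt_def t0 andbT; apply/negP => /eqP te; move: E beq.
  by rewrite te !mul0r !addr0 => ->; rewrite ltxx.
rewrite -(ler_pM2l tp); lra.
Qed.

(* The difference of the two Minkowski sums near [v] is translated by [s *: v]
   when [lam j] grows by [s], because [v] belongs to [T j]. *)
Lemma add_vertex_translate (V : seq 'rV[R]_n) (T : 'I_n -> seq 'rV[R]_n) i j v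
    lam s x :
  let T' k := if k == i then v :: T k else T k in
  (forall k, {subset T k <= V}) -> touches V (T i) -> exposed V v -> v \in V ->
  i != j -> v \in T j -> (forall k, 0 < lam k) -> 0 < s ->
  (hsum T' (incr lam j s) `\` hsum T (incr lam j s)) x <->
  (hsum T' lam `\` hsum T lam) (x - s *: v).
Proof.
move=> T' TV tV ev vV ij vj lam0 s0.
have lam'0 k : 0 < incr lam j s k by rewrite /incr; case: ifP => // _; rewrite addr_gt0.
have ji : j != i by rewrite eq_sym.
have T'j : T' j = T j by rewrite /T' (negPf ji).
have TT' k : {subset T k <= T' k}.
  by move=> p pT; rewrite /T'; case: ifP => // _; rewrite inE pT orbT.
have lbT al mu : lower_bounds T' al mu -> lower_bounds T al mu.
  by move=> lb k p /TT'; exact: lb.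
(* A certificate against a gained point can fail for [T'] only at the new point [v], so every point
   of [T i] lies strictly above [v], and [al] is in the normal cone of [v]. *)
have viol al mu y la : (forall k, 0 < la k) -> hsum T' la y ->
    lower_bounds T al mu -> dotp y al < \sum_k la k * mu k ->
    min_at V v al /\ dotp v al < mu i.
  move=> la0 /(hsum_dual _ _ la0) yT' lb lt.
  have vmu : dotp v al < mu i.
    rewrite ltNge; apply/negP => vmu.
    have lb' : lower_bounds T' al mu.
      move=> k p; rewrite /T'; case: eqP => [->|_]; last exact: lb.
      by rewrite inE => /predU1P[->//|]; exact: lb.
    by move: lt; rewrite ltNge yT'.
  split=> //; apply: touches_exposed tV (TV i) vV ev _ => q /lb.
  exact: lt_le_trans.
have xsv al : dotp (x - s *: v) al = dotp x al - s * dotp v al.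
  by rewrite dotpBl dotpZl.
have notin la y : (forall k, 0 < la k) -> ~ hsum T la y ->
    exists al mu, lower_bounds T al mu /\ dotp y al < \sum_k la k * mu k.
  move=> la0 ny; apply: contrapT => /forallNP h; apply: ny.
  apply/(hsum_dual _ _ la0) => al mu lb; rewrite leNgt; apply/negP => lt.
  by move/forallNP: (h al) => /(_ mu); apply.
have notin' la y : (forall k, 0 < la k) -> ~ hsum T' la y ->
    exists al mu, lower_bounds T' al mu /\ dotp y al < \sum_k la k * mu k.
  move=> la0 ny; apply: contrapT => /forallNP h; apply: ny.
  apply/(hsum_dual _ _ la0) => al mu lb; rewrite leNgt; apply/negP => lt.
  by move/forallNP: (h al) => /(_ mu); apply.
(* Where [v] is minimal, the bound for body [j] can be raised to its exact value, since [v] is in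
   [T j]; growing [lam j] by [s] then adds exactly [s] times the value at [v]. *)
pose repl (mu : 'I_n -> R) c k := if k == j then c else mu k.
have sum_repl (mu : 'I_n -> R) c : \sum_k lam k * repl mu c k =
    \sum_k lam k * mu k + lam j * (c - mu j).
  rewrite (bigD1 j)//= [in RHS](bigD1 j)//= /repl eqxx.
  rewrite (eq_bigr (fun k => lam k * mu k)); first by ring.
  by move=> k /negPf ->.
have repl_lb TT al mu : (forall k, k != j -> forall p, p \in TT k -> mu k <= dotp p al) ->
    {subset TT j <= V} -> min_at V v al -> lower_bounds TT al (repl mu (dotp v al)).
  move=> lb sub mv k p; rewrite /repl; case: eqP => [->|/eqP kj]; last exact: lb.
  by move=> /sub; exact: mv.
have jV : {subset T j <= V} by exact: TV.
have jV' : {subset T' j <= V} by rewrite T'j.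
split=> -[xT' xT]; split.
- apply: contrapT => /(notin' _ _ lam0)[al2 [mu2 [lb2 lt2]]].
  have [al1 [mu1 [lb1 lt1]]] := notin _ _ lam'0 xT.
  have [min1 v1] := viol _ _ _ _ lam'0 xT' lb1 lt1.
  move: lt1 lt2; rewrite sum_incr xsv => lt1 lt2.
  have v1j : mu1 j <= dotp v al1 by exact: lb1.
  have v2j : mu2 j <= dotp v al2 by apply: lb2; rewrite T'j.
  move/(hsum_dual _ _ lam'0): xT' => xT'.
  have [min2|nmin2] := pselect (min_at V v al2).
    have := xT' al2 (repl mu2 (dotp v al2)) (repl_lb T' _ _ (fun k _ => lb2 k) jV' min2).
    rewrite sum_incr sum_repl /repl eqxx.
    have : 0 <= lam j * (dotp v al2 - mu2 j) by rewrite mulr_ge0 ?subr_ge0// ltW.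
    by lra.
  (* Combine the two certificates at the wall: the result is valid even for [T'], because there [q]
     in [T i] ties with the new point [v]. *)
  have [t [t0 mins [q qT E]]] := tV v al1 al2 vV min1 nmin2.
  pose mu k := mu1 k + t * mu2 k.
  have lb k : k != j -> forall p, p \in T' k -> mu k <= dotp p (al1 + t *: al2).
    have lbk k' p : p \in T k' -> mu k' <= dotp p (al1 + t *: al2).
      move=> pT; rewrite dotpDr dotpZr lerD//; first exact: lb1.
      by apply: ler_wpM2l => //; apply: lb2; exact: TT'.
    move=> kj p; rewrite {1}/T'; case: eqP => [->|_]; last exact: lbk.
    by rewrite inE => /predU1P[->|]; [rewrite -E; exact: lbk|exact: lbk].
  have := xT' _ _ (repl_lb T' _ _ lb jV' mins).
  rewrite sum_incr sum_repl /repl eqxx /mu.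
  have -> : \sum_k lam k * (mu1 k + t * mu2 k) =
      \sum_k lam k * mu1 k + t * \sum_k lam k * mu2 k.
    by rewrite mulr_sumr -big_split /=; apply: eq_bigr => k _; ring.
  have h1 : 0 <= lam j * (dotp v (al1 + t *: al2) - (mu1 j + t * mu2 j)).
    rewrite mulr_ge0 ?subr_ge0 ?(ltW (lam0 j))// dotpDr dotpZr lerD//.
    exact: ler_wpM2l.
  have h2 : t * (dotp x al2 - s * dotp v al2) <= t * \sum_k lam k * mu2 k.
    by apply: ler_wpM2l => //; exact: ltW.
  have h3 : s * mu1 j <= s * dotp v al1 by rewrite ler_pM2l.
  move: h1; rewrite !dotpDr !dotpZr => h1.
  by move: lt1 h2 h3 h1; lra.
- move=> xT1; apply: xT; apply/(hsum_dual _ _ lam'0) => al mu lb.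
  move/(hsum_dual _ _ lam0): xT1 => /(_ al mu lb).
  rewrite sum_incr xsv => h.
  have : s * mu j <= s * dotp v al by rewrite ler_pM2l//; exact: lb.
  by lra.
- apply/(hsum_dual _ _ lam'0) => al mu lb.
  move/(hsum_dual _ _ lam0): xT' => /(_ al mu lb).
  rewrite sum_incr xsv => h.
  have : s * mu j <= s * dotp v al by rewrite ler_pM2l//; apply: lb; rewrite T'j.
  by lra.
- move=> /(hsum_dual _ _ lam'0) xT1.
  have [al1 [mu1 [lb1 lt1]]] := notin _ _ lam0 xT.
  have [min1 v1] := viol _ _ _ _ lam0 xT' lb1 lt1.
  have := xT1 al1 _ (repl_lb T _ _ (fun k _ => lb1 k) jV min1).
  rewrite sum_incr sum_repl /repl eqxx; move: lt1; rewrite xsv.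
  have : 0 <= lam j * (dotp v al1 - mu1 j).
    by rewrite mulr_ge0 ?subr_ge0 ?(ltW (lam0 j))//; exact: lb1.
  by lra.
Qed.

Lemma mixed_volume_add_vertex (V : seq 'rV[R]_n) (T : 'I_n -> seq 'rV[R]_n) i j v :
  (forall k, {subset T k <= V}) -> touches V (T i) -> exposed V v -> v \in V ->
  v \in T j ->
  mixed_volume (fun k => hull (if k == i then v :: T k else T k)) =
  mixed_volume (fun k => hull (T k)).
Proof.
move=> TV tV ev vV vj; pose T' k := if k == i then v :: T k else T k.
(* If i = j, then [v] is already in the body and its hull does not change. *)
have [e|ij] := eqVneq i j.
  congr mixed_volume; apply/funext => k; case: eqP => // ->.
  apply/seteqP; split; apply: hull_sub => p; last by rewrite inE orbC => ->.
  by rewrite inE => /predU1P[->|//]; rewrite e.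
have [A AP] := vol_hsum T; have [A' A'P] := vol_hsum T'.
rewrite (mixed_volume_hpoly AP) (mixed_volume_hpoly A'P).
apply: (hcoef_indep (j := j)) => lam s lam0 s0.
have lam'0 k : 0 < incr lam j s k by rewrite /incr; case: ifP => // _; rewrite addr_gt0.
have sub la : hsum T la `<=` hsum T' la.
  apply: hsum_incl => k p pT; rewrite /T'; case: ifP => // _.
  by rewrite inE pT orbT.
have D la : (forall k, 0 < la k) ->
    vol (hsum T' la `\` hsum T la) = (hpoly A' la - hpoly A la)%:E.
  move=> la0; have := vol_split (row_mset_hsum T la0) (row_mset_hsum T' la0) (sub la).
  rewrite A'P// AP//; case: (vol _) => // r [->].
  by rewrite addrC addrK.
apply: EFin_inj; rewrite -!D//.
rewrite -(vol_translate (- (s *: v)) (row_msetD (row_mset_hsum T' lam0) (row_mset_hsum T lam0))).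
congr vol; apply/seteqP; split => x /=.
  by move/(add_vertex_translate x TV tV ev vV ij vj lam0 s0).
by move=> h; apply/(add_vertex_translate x TV tV ev vV ij vj lam0 s0).
Qed.

Lemma touches_sub (V s t : seq 'rV[R]_n) : {subset s <= t} ->
  touches V s -> touches V t.
Proof.
move=> st ts v al1 al2 vV m1 m2; have [u [u0 mu [q qs E]]] := ts v al1 al2 vV m1 m2.
by exists u; split => //; exists q => //; exact: st.
Qed.

Lemma mixed_volume_add_vertices (V : seq 'rV[R]_n) (L : seq ('I_n * 'rV[R]_n))
    (T : 'I_n -> seq 'rV[R]_n) :
  (forall k, {subset T k <= V}) -> (forall k, touches V (T k)) ->
  (forall v, v \in V -> exists j, v \in T j) ->
  (forall iv, iv \in L -> iv.2 \in V /\ exposed V iv.2) ->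
  exists T', [/\ forall k, {subset T k <= T' k}, forall k, {subset T' k <= V},
    forall iv, iv \in L -> iv.2 \in T' iv.1 &
    mixed_volume (fun k => hull (T' k)) = mixed_volume (fun k => hull (T k))].
Proof.
move=> TV tT VT; elim: L => [_|[i v] L IH LV].
  by exists T; split; [move=> k p|exact: TV|move=> iv; rewrite in_nil|].
have [|T1 [TT1 T1V LT1 <-]] := IH.
  by move=> iv ivL; apply: LV; rewrite inE ivL orbT.
have [vV ev] := LV (i, v) (mem_head _ _).
have [j vj] := VT v vV.
exists (fun k => if k == i then v :: T1 k else T1 k); split.
- by move=> k p /TT1 pT; case: ifP => // _; rewrite inE pT orbT.
- move=> k p; case: ifP => _; last exact: T1V.
  by rewrite inE => /predU1P[->//|]; exact: T1V.
- move=> iv; rewrite inE => /predU1P[->|/LT1 h]; first by rewrite eqxx mem_head.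
  by case: ifP => // _; rewrite inE h orbT.
apply: (mixed_volume_add_vertex (V := V) (j := j)) => //.
- by apply: touches_sub (tT i); exact: TT1.
- exact: TT1.
Qed.

(** * Exposed points of a finite list *)

Lemma seq_argmin (f : 'rV[R]_n -> R) (s : seq 'rV[R]_n) : s != [::] ->
  exists2 v, v \in s & forall p, p \in s -> f v <= f p.
Proof.
elim: s => // a [_ _|b s IH _]; first by exists a => [|p]; rewrite inE// => /eqP ->.
have [//|v vs vmin] := IH.
have [le|/ltW le] := leP (f a) (f v).
  exists a; rewrite ?mem_head// => p; rewrite inE => /predU1P[->//|/vmin].
  exact: le_trans.
exists v; first by rewrite inE vs orbT.
by move=> p; rewrite inE => /predU1P[->//|/vmin].
Qed.

Lemma small_eps (f g : 'rV[R]_n -> R) (s : seq 'rV[R]_n) :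
  (forall p, p \in s -> 0 < f p) ->
  exists2 e, 0 < e & forall p, p \in s -> e * `|g p| < f p.
Proof.
elim: s => [_|a s IH h]; first by exists 1.
have [|e e0 eP] := IH; first by move=> p ps; apply: h; rewrite inE ps orbT.
have fa : 0 < f a by apply: h; exact: mem_head.
have ga : 0 < 1 + `|g a| by rewrite ltr_pwDl.
exists (Num.min e (f a / (1 + `|g a|))).
  by rewrite lt_min e0 divr_gt0.
move=> p; rewrite inE => /predU1P[->|ps].
  apply: (@le_lt_trans _ _ (f a / (1 + `|g a|) * `|g a|)).
    by apply: ler_wpM2r => //; rewrite ge_min lexx orbT.
  by rewrite mulrAC ltr_pdivrMr// ltr_pM2l// ltrDr.
apply: le_lt_trans (eP p ps); apply: ler_wpM2r => //.
by rewrite ge_min lexx.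
Qed.

(* Ties among the minimizers are broken by maximal Euclidean norm. *)
Lemma exposed_min (V : seq 'rV[R]_n) al : V != [::] ->
  exists v, [/\ v \in V, exposed V v & min_at V v al].
Proof.
move=> V0; have [v0 v0V v0min] := seq_argmin (fun p => dotp p al) V0.
pose V1 := [seq p <- V | dotp p al == dotp v0 al].
have V10 : V1 != [::].
  have : v0 \in V1 by rewrite mem_filter eqxx.
  by case: V1.
have [v vV1 vmin] := seq_argmin (fun p => - dotp p p) V10.
move: (vV1); rewrite mem_filter => /andP[/eqP vv0 vV].
have [|e e0 eP] := @small_eps (fun p => dotp (p - v) al) (fun p => dotp (p - v) v)
    [seq p <- V | dotp p al != dotp v0 al].
  move=> p; rewrite mem_filter => /andP[pv0 pV].
  by rewrite dotpBl subr_gt0 vv0 lt_neqAle eq_sym pv0 v0min.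
exists v; split => //; last by move=> p pV; rewrite vv0 v0min.
(* A small [e] leaves the strict inequalities of [al] intact, and -e v decides the ties: |p| <= |v|
   and p != v give <p, v> < <v, v>. *)
exists (al - e *: v) => p pV pv.
rewrite -subr_gt0 -dotpBl dotpDr dotpNr dotpZr subr_gt0.
have [pv0|pv0] := boolP (dotp p al == dotp v0 al); last first.
  apply: le_lt_trans (eP p _); last by rewrite mem_filter pv0.
  by rewrite ler_wpM2l ?ler_norm// ltW.
have := vmin p; rewrite mem_filter pv0 pV lerN2 => /(_ isT) le.
rewrite [X in _ < X]dotpBl (eqP pv0) vv0 subrr pmulr_rlt0//.
have : 0 < dotp (p - v) (p - v).
  rewrite lt_def dotp_ge0 andbT; apply: contra pv => /eqP/dotp_eq0/eqP.
  by rewrite subr_eq0.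
rewrite !dotpBl !dotpDr !dotpNr (dotpC v p); move: le.
by lra.
Qed.

Lemma sum_invn : (0 < n)%N -> \sum_(i < n) (n%:R^-1 : R) = 1.
Proof.
by move=> n0; rewrite sumr_const card_ord -[LHS]mulr_natr mulVf// pnatr_eq0 -lt0n.
Qed.

Lemma hull_conv m (w : 'I_m -> R) (q : 'I_m -> 'rV[R]_n) (t : seq 'rV[R]_n) :
  (forall i, 0 <= w i) -> \sum_i w i = 1 -> (forall i, hull t (q i)) ->
  hull t (\sum_i w i *: q i).
Proof.
move=> w0 w1 qt; have ht i := (hullP t (q i)).1 (qt i).
have [u uP] : {u : 'I_m -> 'I_(size t) -> R & forall i, [/\ forall j, 0 <= u i j,
    \sum_j u i j = 1 & q i = \sum_j u i j *: t`_j]}.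
  exact: boolp.choice ht.
apply/hullP; exists (fun j => \sum_i w i * u i j); split=> [j||].
- by apply: sumr_ge0 => i _; rewrite mulr_ge0//; case: (uP i).
- rewrite exchange_big /= -w1; apply: eq_bigr => i _.
  by rewrite -mulr_sumr; case: (uP i) => _ -> _; rewrite mulr1.
transitivity (\sum_i \sum_j (w i * u i j) *: t`_j).
  apply: eq_bigr => i _; case: (uP i) => _ _ ->; rewrite scaler_sumr.
  by apply: eq_bigr => j _; rewrite scalerA.
by rewrite exchange_big /=; apply: eq_bigr => j _; rewrite scaler_suml.
Qed.

(** Every linear form attains its minimum over [V] at an exposed point, so no certificate can refute
    a point of [V]. *)
Lemma hull_exposed (V s : seq 'rV[R]_n) : (0 < n)%N -> {subset s <= V} ->
  (forall v, v \in V -> exposed V v -> v \in s) -> hull s = hull V.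
Proof.
move=> n0 sV Vs; apply/seteqP; split; first exact: hull_sub.
have lam0 (i : 'I_n) : 0 < (n%:R^-1 : R) by rewrite invr_gt0 ltr0n.
have lam1 := sum_invn n0.
have Vhull p : p \in V -> hull s p.
  (* With n copies and weights 1/n the Minkowski sum is the hull itself, so [hsum_dual] serves as a
     membership criterion. *)
  move=> pV; suff : hsum (fun=> s) (fun=> n%:R^-1) p.
    move=> [q [qs ->]]; apply: hull_conv => // i; exact: ltW (lam0 i).
  apply/(hsum_dual _ _ lam0) => al mu lb.
  have [v [vV ev vmin]] := exposed_min al (V := V) (ltac:(by case: (V) pV)).
  have le i : mu i <= dotp v al by apply: lb; exact: Vs.
  apply: le_trans (vmin p pV).
  rewrite -[leRHS]mul1r -[X in _ <= X * _]lam1 mulr_suml; apply: ler_sum => i _.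
  by apply: ler_wpM2l => //; exact: ltW (lam0 i).
by move=> x [m [w [q [w0 w1 qV ->]]]]; apply: hull_conv => // i; exact/Vhull/qV.
Qed.

(** * The case of equal bodies *)

Lemma hsum_cst (V : seq 'rV[R]_n) lam x : (0 < n)%N -> (forall i, 0 < lam i) ->
  hsum (fun=> V) lam ((\sum_i lam i) *: x) <-> hull V x.
Proof.
move=> n0 lam0; have L0 : 0 < \sum_i lam i.
  rewrite (bigD1 (Ordinal n0))//= ltr_pwDl// sumr_ge0// => i _; exact: ltW.
split=> [[q [qV E]]|Vx]; last first.
  by exists (fun=> x); split => //; rewrite scaler_suml.
have -> : x = \sum_i (lam i / \sum_k lam k) *: q i.
  apply: (scalerI (lt0r_neq0 L0)); rewrite E scaler_sumr.
  by apply: eq_bigr => i _; rewrite scalerA mulrC divfK// gt_eqF.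
apply: hull_conv => // [i|]; first by rewrite divr_ge0// ltW.
by rewrite -mulr_suml divff// gt_eqF.
Qed.

Lemma hull_scale_msum (V : seq 'rV[R]_n) lam : (0 < n)%N -> (forall i, 0 < lam i) ->
  hull V = [set x | hsum (fun=> V) lam (x *m diag_mx (const_mx (\sum_i lam i)))].
Proof.
move=> n0 lam0; rewrite diag_const_mx.
by apply/seteqP; split => x /=; rewrite mul_mx_scalar hsum_cst.
Qed.

Lemma row_mset_hull (V : seq 'rV[R]_n) : (0 < n)%N -> row_mset (hull V).
Proof.
move=> n0; rewrite (@hull_scale_msum V (fun=> 1))//.
rewrite (_ : [set x | _] = [set x | hsum (fun=> V) (fun=> 1)
  (x *m diag_mx (const_mx (\sum_(i < n) 1)) + 0)]).
  by apply: row_mset_mul; apply: row_mset_hsum => i.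
by apply/seteqP; split => x /=; rewrite addr0.
Qed.

Lemma mixed_volume_cst (V : seq 'rV[R]_n) : (0 < n)%N ->
  (mixed_volume (fun _ : 'I_n => hull V))%:E = (n`!%:R%:E * vol (hull V))%E.
Proof.
move=> n0.
have volE lam : (forall i, 0 < lam i) ->
    (vol (hsum (fun=> V) lam) = ((\sum_i lam i) ^+ n)%:E * vol (hull V))%E.
  move=> lam0; have L0 : 0 < \sum_i lam i.
    rewrite (bigD1 (Ordinal n0))//= ltr_pwDl// sumr_ge0// => i _; exact: ltW.
  rewrite (@vol_diag _ _ (const_mx (\sum_i lam i))); first last.
  - exact: row_mset_hsum.
  - by move=> j; rewrite mxE.
  rewrite -hull_scale_msum//; congr (_%:E * _)%E.
  by rewrite (eq_bigr (fun=> \sum_i lam i)) ?prodr_const ?card_ord// => j _; rewrite mxE.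
have [A AP] := vol_hsum (fun _ : 'I_n => V).
(* Finiteness of the volume: with weights 1/n the sum of the bodies has the volume of the hull, and
   that is a polynomial value. *)
have [r rE] : exists r, vol (hull V) = r%:E.
  have lam0 (i : 'I_n) : 0 < (n%:R^-1 : R) by rewrite invr_gt0 ltr0n.
  have := volE _ lam0; rewrite AP// sum_invn//.
  by rewrite expr1n mul1e => <-; exists (hpoly A (fun=> n%:R^-1)).
rewrite (mixed_volume_hpoly (A := fun=> r)); last first.
  move=> lam lam0; rewrite -/(hsum (fun=> V) lam) volE// rE -EFinM hpoly_cst.
  by rewrite mulrC.
by rewrite hcoef_cst EFinM rE.
Qed.

(* The first wall hit when moving from [al1] towards [al2] out of the normal
   cone of [v]. *)
Lemma wall (V : seq 'rV[R]_n) v al1 al2 : v \in V -> min_at V v al1 ->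
  ~ min_at V v al2 -> exists t p, [/\ 0 <= t, min_at V v (al1 + t *: al2),
    p \in V, p != v & dotp p (al1 + t *: al2) = dotp v (al1 + t *: al2)].
Proof.
move=> vV m1 /existsNP[p0] /not_implyP[p0V] /negP; rewrite -ltNge => lt0.
pose N := [seq p <- V | dotp p al2 < dotp v al2].
have N0 : N != [::].
  have : p0 \in N by rewrite mem_filter lt0.
  by case: N.
(* The ratio is the t at which [p] ties with [v]; the least one gives the first wall. *)
have [p pN pmin] := seq_argmin (fun p => dotp (p - v) al1 / dotp (v - p) al2) N0.
move: pN; rewrite mem_filter => /andP[plt pV].
have d0 q : dotp q al2 < dotp v al2 -> 0 < dotp (v - q) al2.
  by rewrite dotpBl subr_gt0.
have n0 q : q \in V -> 0 <= dotp (q - v) al1 by move=> qV; rewrite dotpBl subr_ge0 m1.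
exists (dotp (p - v) al1 / dotp (v - p) al2), p; split => //.
- by rewrite divr_ge0 ?n0// ltW// d0.
- move=> q qV; rewrite -subr_ge0 -dotpBl dotpDr dotpZr.
  have [ge|lt] := leP (dotp v al2) (dotp q al2).
    rewrite addr_ge0 ?n0// mulr_ge0//; last by rewrite dotpBl subr_ge0.
    by rewrite divr_ge0 ?n0// ltW// d0.
  have := pmin q; rewrite mem_filter lt qV => /(_ isT).
  rewrite ler_pdivlMr ?d0// -subr_ge0; congr (0 <= _).
  by rewrite -[q - v]opprB [in X in _ = _ + X]dotpNl mulrN.
- by apply: contraTneq plt => ->; rewrite ltxx.
apply/eqP; rewrite -subr_eq0 -dotpBl dotpDr dotpZr; apply/eqP.
rewrite -[X in _ + _ * X]opprK -dotpNl opprB mulrN divfK ?subrr//.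
by rewrite gt_eqF// d0.
Qed.

(** * From faces to normal cones *)

Lemma face_wall (V : seq 'rV[R]_n) v al q : v \in V -> min_at V v al ->
  face_dir (hull V) al q <-> hull V q /\ dotp q al = dotp v al.
Proof.
move=> vV vmin; split=> [[Vq qmin]|[Vq qv]]; split=> //.
  apply/eqP; rewrite eq_le (hull_ge Vq vmin) andbT.
  by apply: qmin; exact: hull_mem.
by move=> y Vy; rewrite qv; exact: hull_ge Vy vmin.
Qed.

Definition meets_faces (V s : seq 'rV[R]_n) := forall F : set 'rV[R]_n,
  is_face (hull V) F -> F <> hull V -> positive_dim F ->
  exists2 q, q \in s & F q.

Lemma meets_faces_wall (V s : seq 'rV[R]_n) v al p : meets_faces V s ->
  v \in V -> min_at V v al -> p \in V -> p != v -> dotp p al = dotp v al ->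
  face_dir (hull V) al <> hull V ->
  exists2 q, q \in s & dotp q al = dotp v al.
Proof.
move=> meets vV vmin pV pv pE FP.
have [||q qs /(face_wall _ vV vmin)[_ qE]] := meets (face_dir (hull V) al) _ FP.
- exists al; split => //; apply: contra_not_neq FP => ->.
  apply/seteqP; split => [x []//|x Vx]; split => // y _.
  by rewrite !dotp0r.
- exists p, v; split => //; apply/(face_wall _ vV vmin); split => //; exact: hull_mem.
by exists q.
Qed.

(** The face at the wall contains [v] and a second point. If it is proper, the hypothesis applies;
    if it is the whole, flat hull, any point of [s] ties with [v]. *)
Lemma meets_faces_touches (V s : seq 'rV[R]_n) : s != [::] -> {subset s <= V} ->
  meets_faces V s -> touches V s.
Proof.
move=> s0 sV meets v al1 al2 vV m1 nm2.
have [t [p [t0 mt pV pv pE]]] := wall vV m1 nm2.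
exists t; split => //.
have [FP|FP] := pselect (face_dir (hull V) (al1 + t *: al2) = hull V); last first.
  exact: meets_faces_wall pE FP.
have [q qs] : exists q, q \in s by case: (s) s0 => // q *; exists q; exact: mem_head.
exists q => //; have : face_dir (hull V) (al1 + t *: al2) q.
  by rewrite FP; apply: hull_mem; exact: sV.
by move/(face_wall _ vV mt) => [].
Qed.

Lemma hull_nil : hull ([::] : seq 'rV[R]_n) = set0.
Proof.
apply/seteqP; split => // x /hullP[w [_ + _]]; rewrite big_ord0 => /esym/eqP.
by rewrite oner_eq0.
Qed.

(* If [hull V] had interior, some proper face through an exposed point would
   have positive dimension: pick a direction not proportional to the exposing
   one and move to the first wall. *)
Lemma vol_hull_no_faces (V : seq 'rV[R]_n) : (1 < n)%N -> meets_faces V [::] ->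
  vol (hull V) = 0%E.
Proof.
move=> n1 meets; have n0 := ltnW n1.
have [->|V0] := eqVneq V [::]; first by rewrite hull_nil vol_set0.
have [v [vV [be bev] _]] := exposed_min 0 V0.
apply: contrapT => vol0.
have nflat al : al != 0 -> exists2 p, p \in V & dotp p al != dotp v al.
  move=> al0; apply: contrapT => h; apply: vol0.
  apply: vol_null (row_mset_hull V n0) _ _ (vol_hyperplane (- dotp v al) al0).
    apply: row_mset_affine_eq0; apply: is_affineD; first exact: is_affine_cst.
    exact: is_affine_dotp.
  have E p : p \in V -> dotp p al = dotp v al.
    by move=> pV; apply/eqP; apply: contrapT => /negP np; apply: h; exists p.
  move=> x Vx /=; apply/eqP; rewrite addrC subr_eq0 eq_le.
  rewrite (hull_ge Vx) ?andbT; last by move=> p /E ->.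
  by rewrite -lerN2 -!dotpNr (hull_ge Vx)// => p /E; rewrite !dotpNr => ->.
pose e0 : 'rV[R]_n := delta_mx 0 (Ordinal n0).
pose e1 : 'rV[R]_n := delta_mx 0 (Ordinal n1).
have e00 : e0 != 0.
  apply/eqP => /rowP/(_ (Ordinal n0)); rewrite !mxE !eqxx => /eqP.
  by rewrite oner_eq0.
have e10 : e1 != 0.
  apply/eqP => /rowP/(_ (Ordinal n1)); rewrite !mxE !eqxx => /eqP.
  by rewrite oner_eq0.
have be0 : be != 0.
  apply/eqP => be0; have [p pV] := nflat e0 e00; have [->|pv] := eqVneq p v.
    by rewrite eqxx.
  by have := bev p pV pv; rewrite be0 !dotp0r ltxx.
(* A direction not proportional to [be], so that no normal on the way vanishes: if [be] is a
   multiple of [e0], take [e1], available since n > 1. *)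
have [al al0 alN] : exists2 al : 'rV[R]_n, al != 0 & forall t, be + t *: al != 0.
  have [h|/existsNP[t /negP/negPn/eqP ht]] :=
    pselect (forall t, be + t *: e0 != 0); first by exists e0.
  exists e1 => // u; apply: contra be0 => /eqP hu.
  have t0 : t = 0.
    have /rowP/(_ (Ordinal n0)) := ht; have /rowP/(_ (Ordinal n0)) := hu.
    by rewrite !mxE !eqxx /= mulr0 addr0 => ->; rewrite add0r mulr1.
  by move: ht; rewrite t0 scale0r addr0 => ->.
(* As [al] is not constant on [V], one of [al] and [- al] is outside the normal cone of [v]. *)
have [al2 al20 [al2N nm2]] : exists2 al2 : 'rV[R]_n, al2 != 0 &
    (forall t, be + t *: al2 != 0) /\ ~ min_at V v al2.
  have [p pV] := nflat al al0; rewrite neq_lt => /orP[lt|lt].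
    by exists al => //; split => // /(_ p pV); apply/negP; rewrite -ltNge.
  exists (- al); rewrite ?oppr_eq0//; split => [t|/(_ p pV)].
    by rewrite scalerN -scaleNr.
  by apply/negP; rewrite -ltNge !dotpNr ltrN2.
have bemin : min_at V v be.
  by move=> p pV; have [->//|pv] := eqVneq p v; exact/ltW/bev.
have [t [p [_ mt pV pv pE]]] := wall vV bemin nm2.
have [|q //] := meets_faces_wall meets vV mt pV pv pE.
move=> FP; have [q qV] := nflat _ (al2N t); apply/negP/negPn/eqP.
have : face_dir (hull V) (be + t *: al2) q by rewrite FP; exact: hull_mem.
by move/(face_wall _ vV mt) => [].
Qed.

Lemma mixed_volume_empty (T : 'I_n -> seq 'rV[R]_n) i : T i = [::] ->
  mixed_volume (fun k => hull (T k)) = 0.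
Proof.
move=> Ti; rewrite (mixed_volume_hpoly (A := fun=> 0)).
  by rewrite hcoef_cst mulr0.
move=> lam lam0; rewrite hpoly_cst mul0r (_ : Defs.msum _ _ = set0) ?vol_set0//.
by apply/seteqP; split => // x [q [/(_ i)]]; rewrite Ti hull_nil.
Qed.

Theorem mixed_volume_meets_faces (T : 'I_n -> seq 'rV[R]_n) (V : seq 'rV[R]_n) :
  (0 < n)%N -> (forall p, p \in V <-> exists i, p \in T i) ->
  (forall i, meets_faces V (T i)) ->
  (mixed_volume (fun i => hull (T i)))%:E = (n`!%:R%:E * vol (hull V))%E.
Proof.
move=> n0 VT meets.
have TV i : {subset T i <= V} by move=> p pT; apply/VT; exists i.
(* With an empty [T i] the hypothesis says that the hull has no proper face of positive
   dimension. *)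
have [[i Ti]|nT] := pselect (exists i, T i = [::]).
  rewrite (mixed_volume_empty Ti).
  suff -> : vol (hull V) = 0%E by rewrite mule0.
  have [n1|n1] := ltnP 1 n.
    by apply: vol_hull_no_faces n1 _; rewrite -Ti; exact: meets.
  (* In dimension 1 the empty list is the only one, so [V] is empty too. *)
  suff -> : V = [::] by rewrite hull_nil vol_set0.
  apply/eqP; rewrite -size_eq0 -leqn0 leqNgt -has_predT; apply/negP => /hasP[p pV _].
  have [k] := (VT p).1 pV.
  have z (l : 'I_n) : l = 0 :> nat.
    by apply/eqP; rewrite -leqn0 -ltnS (leq_trans (ltn_ord l) n1).
  have -> : k = i by apply/val_inj; rewrite /= !z.
  by rewrite Ti.
have tT i : touches V (T i).
  by apply: meets_faces_touches (TV i) (meets i); apply/eqP => Ti; apply: nT; exists i.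
pose L := [seq (i, v) | i <- enum 'I_n, v <- [seq v <- V | `[< exposed V v >]]].
have [|iv|T' [TT' T'V LT' <-]] := mixed_volume_add_vertices (L := L) TV tT.
- by move=> v /VT.
- by move=> /allpairsP[[i v] /= [_ + ->]]; rewrite mem_filter => /andP[/asboolP].
rewrite (_ : (fun k => hull (T' k)) = fun=> hull V); first exact: mixed_volume_cst.
apply/funext => k; apply: hull_exposed => // v vV ev.
apply: (LT' (k, v)); apply/allpairsP; exists (k, v); split => //=.
  by rewrite mem_enum.
by rewrite mem_filter vV andbT; apply/asboolP.
Qed.

End MixedVolume.

Theorem theorem1 (R : realType) (n : nat) (hn : (1 <= n)%N)
  (S : 'I_n -> seq 'rV[rat]_n) :
  let St : set 'rV[R]_n := [set x | exists i : 'I_n, exists2 s, s \in S i & x = ratv R s] in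
  (forall F : set 'rV[R]_n,
      is_face (conv_hull St) F -> F <> conv_hull St -> positive_dim F ->
      forall i : 'I_n, exists2 s, s \in S i & F (ratv R s)) ->
  (mixed_volume (fun i => conv_hull [set x | exists2 s, s \in S i & x = ratv R s]))%:E
  = ((n`!)%:R%:E * vol (conv_hull St))%E.
Proof.
move=> St meets; pose T i := [seq ratv R s | s <- S i].
pose V := flatten [seq T i | i <- enum 'I_n].
have TE i : [set x | exists2 s, s \in S i & x = ratv R s] = [set x | x \in T i].
  apply/seteqP; split => x /=; first by move=> [s sS ->]; exact: map_f.
  by move=> /mapP.
have VT p : p \in V <-> exists i, p \in T i.
  split=> [/flatten_mapP[i _ pT]|[i pT]]; first by exists i.
  by apply/flatten_mapP; exists i; rewrite ?mem_enum.
have VE : St = [set x | x \in V].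
  apply/seteqP; split => x /=.
    move=> [i [s sS xs]]; apply/VT; exists i; apply/mapP; by exists s.
  by move=> /VT[i /mapP[s sS ->]]; exists i, s.
under eq_fun do rewrite TE.
rewrite VE in meets *; apply: (mixed_volume_meets_faces hn VT) => i F Ff FP Fd.
have [s sS Fs] := meets F Ff FP Fd i.
by exists (ratv R s) => //; exact: map_f.
Qed.
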